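(* Let $G$ be a profinite group. For every commutative ring $R$ with identity and every open subgroup $U$ of $G$: (a) $\mathrm{Res}_U^G(R)\circ\tau_R^G=\tau_R^U\circ f_U$; (b) $\mathbf{Res}_U^G(R)\circ\theta_R^G=\theta_R^U\circ\mathrm{Res}_U^G(R)$; (c) $\mathbf{Res}_U^G(R)\circ\gamma_R^G=\gamma_R^U\circ f_U$.
   Context: Conventions. All rings are commutative, associative, with $1\neq 0$. $G$ is a profinite group; $U,V,W$ denote open subgroups; $\mathcal O(G)$ is the set of open subgroups of $G$. $U\lesssim V$ means that $U$ is contained in a $G$-conjugate of $V$, and then $(V:U)$ denotes the index of $U$ in such a conjugate. $\varphi_U(G/V)$ is the number of $U$-fixed points of $G/V$. A prime on $\sum$ or $\prod$ means that exactly one open subgroup from each conjugacy class is taken. $Z(g,V,W):=V\cap gWg^{-1}$. The same notation is used for an open subgroup $U$ of $G$ regarded as a profinite group (with $U$-conjugacy classes). $W_G$ (Dress-Siebeneicher) is the unique functor from commutative rings to commutative rings such that: as a set $W_G(A)$ is the set of maps $\mathcal O(G)\to A$ constant on conjugacy classes; $W_G(h)(\alpha)=h\circ\alpha$; and for every open $V$ the map $\phi_V^{A,G}:W_G(A)\to A$, $\alpha\mapsto\sum'_{V\lesssim W\leqslant G}\varphi_V(G/W)\,\alpha(W)^{(W:V)}$, is a ring homomorphism, natural in $A$. For an ideal $I$ of $A$, $W_G(I)$ denotes the set of $\alpha\in W_G(A)$ with all values in $I$. The restriction $f_U:W_G(A)\to W_U(A)$ is the unique family of maps, natural in the ring $A$,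 with $\phi_V^{A,U}(f_U(\alpha))=\phi_V^{A,G}(\alpha)$ for all open $V\leqslant U$; it is a ring homomorphism given by universal integral polynomials. Rings $\Delta_G(R)$, $\mathcal{AP}_G(R)$ and maps. Case 1: $R\supseteq\mathbb Q$. $\Delta_G(R)$ is the set $\prod'_{V\leqslant G}R$ with componentwise addition and multiplication $(\mathbf x\mathbf y)_U=\sum'_{V,W}p_V^W(U)x_Vy_W$, where $p_V^W(U)$ is the number of double cosets $VgW\subseteq G$ with $Z(g,V,W)$ conjugate to $U$ in $G$. $\mathcal{AP}_G(R)$ is the same additive group with multiplication $(\mathbf x\mathbf y)_U=\sum'_{V,W}\sum_g\frac{(G:Z(g,V,W))}{(G:V)(G:W)}x_Vy_W$, where $g$ runs over representatives of the double cosets $VgW$ with $Z(g,V,W)$ conjugate to $U$. For $r\in R$, $(M_G(r,V))'_V$ is the unique family with $\sum'_{U\lesssim V\leqslant G}\varphi_U(G/V)M_G(r,V)=r^{(G:U)}$ for all open $U\leqslant G$; $\tau^G(R)(r):=(M_G(r,V))'_V$, and similarly $\tau^U(R):R\to\Delta_U(R)$. $\mathrm{Ind}_U^G(R):\Delta_U(R)\to\Delta_G(R)$ sends $(x_V)'_{V\leqslant U}$ to $(y_W)'_{W\leqslant G}$, where $y_W$ is the sum of those $x_V$ (one per $U$-conjugacy class) with $V$ conjugate to $W$ in $G$. $\tau_R^G(\alpha):=\sum'_{U\leqslant G}\mathrm{Ind}_U^G(R)(\tau^U(R)(\alpha(U)))$, $\theta_R^G((x_V)'_V):=((G:V)x_V)'_V$.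 The restrictions are $$\mathrm{Res}_U^G(R):\Delta_G(R)\to\Delta_U(R),\quad (b_V)'_{V\leqslant G}\mapsto\Big(\sum_V{}^{\!\prime}\sum_g b_V\Big)'_{W\leqslant U},$$ $$\mathbf{Res}_U^G(R):\mathcal{AP}_G(R)\to\mathcal{AP}_U(R),\quad (b_V)'_{V\leqslant G}\mapsto\Big(\sum_V{}^{\!\prime}\sum_g\frac{(U:W)}{(G:V)}\,b_V\Big)'_{W\leqslant U},$$ where, for given $V$ and $W$, $g$ ranges over representatives of the $U$-orbits of $G/V$ (i.e. of double cosets $UgV$) such that $Z(g,U,V)$ is conjugate to $W$ in $U$. Case 2: $R$ torsion-free, not containing $\mathbb Q$. With $R\mathbb Q=R\otimes_{\mathbb Z}\mathbb Q$: $\Delta_G(R):=\tau^G_{R\mathbb Q}(W_G(R))\subset\Delta_G(R\mathbb Q)$, $\mathcal{AP}_G(R):=\theta_{R\mathbb Q}^G(\Delta_G(R))\subset\mathcal{AP}_G(R\mathbb Q)$, and $\tau_R^G,\theta_R^G,\mathrm{Res}_U^G(R),\mathbf{Res}_U^G(R)$ are the restrictions of the corresponding maps for $R\mathbb Q$ (which do restrict). Case 3: $R$ not torsion-free. Choose a surjective ring homomorphism $\rho:R'\to R$ with $R'$ torsion-free (e.g. $R'=\mathbb Z[R]$, with $\mathbb Z$-basis $e_r$, $e_re_s=e_{rs}$, $\rho(e_r)=r$). Put $\Delta_G(\ker\rho)=\tau_{R'}^G(W_G(\ker\rho))$, $\mathcal{AP}_G(\ker\rho)=\theta_{R'}^G(\Delta_G(\ker\rho))$,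 $\Delta_G(R)=\Delta_G(R')/\Delta_G(\ker\rho)$, $\mathcal{AP}_G(R)=\mathcal{AP}_G(R')/\mathcal{AP}_G(\ker\rho)$, and let $\tau_R^G$ (on $W_G(R)=W_G(R')/W_G(\ker\rho)$), $\theta_R^G$, $\mathrm{Res}_U^G(R)$, $\mathbf{Res}_U^G(R)$ be the maps induced by those of $R'$. In all cases $\gamma_R^G:=\theta_R^G\circ\tau_R^G:W_G(R)\to\mathcal{AP}_G(R)$. *)

(* Defs.v *)
From HB Require Import structures.
From mathcomp Require Import all_boot all_order all_algebra finmap.
From mathcomp Require Import all_classical topology.

Set Implicit Arguments.
Unset Strict Implicit.
Unset Printing Implicit Defensive.

Import GRing.Theory.

Local Open Scope classical_set_scope.
Local Open Scope ring_scope.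

HB.mixin Record isProfinite G of Group G & Topological G := {
  mulg_continuous : continuous (fun xy : G * G => (xy.1 * xy.2)%g) ;
  invg_continuous : continuous (fun x : G => x^-1%g) ;
  profinite_hausdorff : hausdorff_space G ;
  profinite_compact : compact [set: G] ;
  profinite_disconnected : totally_disconnected [set: G]
}.

#[short(type="profiniteGroupType")]
HB.structure Definition ProfiniteGroup :=
  {G of Group G & Topological G & isProfinite G}.

(* [osubgroup K] is the set O(K) of open subgroups of K, where K is [set: G]
   or an open subgroup of G.  Since K is open in G, the subgroups of K that are
   open for the subspace topology are the open subgroups of G inside K; all
   constructions below are made inside G, relatively to such a K. *)
Record osubgroup (G : profiniteGroupType) (K : set G) := OSubgroup {
  osubgroup_set :> set G ;
  osubgroup_sub : osubgroup_set `<=` K ;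
  osubgroup1 : osubgroup_set 1%g ;
  osubgroupM : forall x y, osubgroup_set x -> osubgroup_set y ->
                 osubgroup_set (x * y)%g ;
  osubgroupV : forall x, osubgroup_set x -> osubgroup_set x^-1%g ;
  osubgroup_open : open osubgroup_set
}.

HB.instance Definition _ (G : profiniteGroupType) (K : set G) :=
  gen_eqMixin (osubgroup K).
HB.instance Definition _ (G : profiniteGroupType) (K : set G) :=
  gen_choiceMixin (osubgroup K).

Section Groups.
Variable G : profiniteGroupType.
Implicit Types (g k : G) (K U V W : set G).

(* g V g^-1 *)
Definition conjset g V : set G := [set (g * v * g^-1)%g | v in V].

Definition lcoset g V : set G := [set (g * v)%g | v in V].

(* U g V *)
Definition dcoset U g V : set G :=
  [set x | exists2 u, U u & exists2 v, V v & x = (u * g * v)%g].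

Definition conj_in K V W := exists2 k, K k & W = conjset k V.

(* U <~ V in K *)
Definition subconj K U V := exists2 k, K k & U `<=` conjset k V.

(* K / V *)
Definition lcosets K V : set (set G) := [set lcoset k V | k in K].

(* (K : V) *)
Definition gindex K V : nat := #|` fset_set (lcosets K V)|.

(* (V : U) when U <~ V in K: the index of U in a K-conjugate of V containing U
   (it does not depend on that conjugate). *)
Definition index_conj K V U : nat :=
  gindex (xget V [set V' | conj_in K V V' /\ U `<=` V']) U.

(* the number of U-fixed points of K / V *)
Definition fixpts U K V : nat :=
  #|` fset_set [set C | lcosets K V C /\
                        forall u, U u -> [set (u * x)%g | x in C] = C] |.

(* Z(g, V, W) *)
Definition Zset g V W : set G := V `&` conjset g W.

(* For V <= K and W <= U: the double cosets U g V in K such that Z(g, U, V) is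
   conjugate to W in U. *)
Definition dcosets K U V W : set (set G) :=
  [set D | exists g, [/\ K g, D = dcoset U g V & conj_in U (Zset g U V) W]].

Definition class_repr K (V : osubgroup K) : osubgroup K :=
  xget V [set V' : osubgroup K | conj_in K V V'].

(* A system of representatives of the conjugacy classes of open subgroups of K:
   primed sums and products are indexed by [ccl K]. *)
Definition ccl K : set (osubgroup K) :=
  [set V : osubgroup K | class_repr V = V].
Arguments ccl : clear implicits.

Record wmap K (A : Type) := WMap {
  wmap_fun :> osubgroup K -> A ;
  wmap_class : forall V V' : osubgroup K, conj_in K V V' ->
                 wmap_fun V = wmap_fun V'
}.

Definition wmap_comp K (A B : Type) (h : A -> B) (a : wmap K A) : wmap K B :=
  WMap (fun _ _ c => congr1 h (wmap_class a c)).

(* phi_V^{A, K} *)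
Definition ghost K (A : comNzRingType) V (a : wmap K A) : A :=
  \sum_(W \in [set W : ccl K | subconj K V (val W)])
     (a (val W) ^+ index_conj K (val W) V) *+ fixpts V K (val W).

Definition is_ring_hom (A B : pzRingType) (f : A -> B) : Prop :=
  zmod_morphism f /\ monoid_morphism f.

Definition wring K (c : forall A : comNzRingType, GRing.ComNzRing (wmap K A))
  (A : comNzRingType) : comNzRingType := GRing.ComNzRing.Pack (c A).

(* The functor W_K: ring structures on the sets [wmap K A], such that
   W_K(h) = [wmap_comp h] and the phi_V are ring homomorphisms.  (The
   naturality of phi_V, which does not involve the ring structure of W_K(A),
   holds automatically.) *)
Record wittBurnside K := WittBurnside {
  witt_class : forall A : comNzRingType, GRing.ComNzRing (wmap K A) ;
  witt_map_hom : forall (A B : comNzRingType) (h : {rmorphism A -> B}),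
    is_ring_hom (wmap_comp h : wring witt_class A -> wring witt_class B) ;
  witt_ghost_hom : forall (A : comNzRingType) (V : osubgroup K),
    is_ring_hom (ghost V : wring witt_class A -> A)
}.

Definition witt K (w : wittBurnside K) (A : comNzRingType) : comNzRingType :=
  wring (witt_class w) A.

(* The property defining the family f_U = (f_U^A)_A : W_K(A) -> W_U(A). *)
Definition is_witt_restriction K U (wK : wittBurnside K) (wU : wittBurnside U)
    (f : forall A : comNzRingType, witt wK A -> witt wU A) : Prop :=
  (forall (A B : comNzRingType) (h : {rmorphism A -> B}) (a : witt wK A),
     f B (wmap_comp h a) = wmap_comp h (f A a)) /\
  (forall (A : comNzRingType) (a : witt wK A) (V : osubgroup U),
     ghost V (f A a) = ghost V a).

Section RationalCoefficients.
Variables (S : comNzRingType) (h : {rmorphism rat -> S}).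

(* (M_K(r, V))'_V, that is tau^K(S)(r) *)
Definition necklace K (r : S) : ccl K -> S :=
  xget (fun=> 0) [set M : ccl K -> S | forall U : osubgroup K,
    \sum_(V \in [set V : ccl K | subconj K U (val V)])
       M V *+ fixpts U K (val V)
      = r ^+ gindex K U].

Definition Ind K U (x : ccl U -> S) : ccl K -> S := fun W : ccl K =>
  \sum_(V \in [set V : ccl U | conj_in K (val V) (val W)]) x V.

(* tau_S^K; at each W, only the finitely many U with W <~ U contribute. *)
Definition tauQ K (a : wmap K S) : ccl K -> S := fun W : ccl K =>
  \sum_(U \in [set: ccl K]) Ind (K := K) (necklace (K := val U) (a (val U))) W.

(* theta_S^K *)
Definition thetaQ K (x : ccl K -> S) : ccl K -> S := fun V : ccl K =>
  x V *+ gindex K (val V).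

(* Res_U^K *)
Definition ResQ K U (b : ccl K -> S) : ccl U -> S := fun W : ccl U =>
  \sum_(V \in [set: ccl K]) \sum_(D \in dcosets K U (val V) (val W)) b V.

(* bold Res_U^K *)
Definition bResQ K U (b : ccl K -> S) : ccl U -> S := fun W : ccl U =>
  \sum_(V \in [set: ccl K]) \sum_(D \in dcosets K U (val V) (val W))
     h ((gindex U (val W))%:R / (gindex K (val V))%:R) * b V.

End RationalCoefficients.
End Groups.

Arguments ccl {G} K _.
Arguments Ind {G S} K U x _.
Arguments ResQ {G S} K U b _.
Arguments bResQ {G S} h K U b _.

Definition torsion_free (R : zmodType) : Prop :=
  forall (x : R) (n : nat), (0 < n)%N -> x *+ n = 0 -> x = 0.

Definition contains_rat (R : pzRingType) : Prop :=
  inhabited {rmorphism rat -> R}.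

(* S = R (x)_Z Q, with canonical maps i and h: the tensor product of R and Q in
   the category of commutative rings is their coproduct. *)
Definition is_tensor_rat (R S : comNzRingType) (i : {rmorphism R -> S})
    (h : {rmorphism rat -> S}) : Prop :=
  forall (T : comNzRingType) (u : {rmorphism R -> T})
      (v : {rmorphism rat -> T}),
    exists w : {rmorphism S -> T},
      [/\ forall x, w (i x) = u x, forall q, w (h q) = v q
        & forall w' : {rmorphism S -> T}, (forall x, w' (i x) = u x) ->
            (forall q, w' (h q) = v q) -> forall s, w' s = w s].

(* The three cases for a coefficient ring R, with the auxiliary choices: R (x) Q
   in the second case, rho : R' -> R and R' (x) Q in the third one.  In the
   third case R' does not contain Q, because R does not. *)
Variant coef_case (R : comNzRingType) : Type :=
| ContainsQ of {rmorphism rat -> R}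
| TorsionFree (S : comNzRingType) (i : {rmorphism R -> S})
    (h : {rmorphism rat -> S}) of
    torsion_free R & ~ contains_rat R & is_tensor_rat i h
| Torsion (R' S : comNzRingType) (rho : {rmorphism R' -> R})
    (i : {rmorphism R' -> S}) (h : {rmorphism rat -> S}) of
    ~ torsion_free R & torsion_free R' & set_surj [set: R'] [set: R] rho
    & is_tensor_rat i h.

(* The quotient X / I, as a set of cosets of I. *)
Definition quotient (V : Type) (S : zmodType) (X I : set (V -> S)) :
    set (set (V -> S)) :=
  [set C | exists2 x, X x & C = [set x \+ k | k in I]].

Section Cosets.
Variables (V V' : Type) (S S' : zmodType).
Variables (X I : set (V -> S)) (X' I' : set (V' -> S')).

Definition coset (x : X) : quotient X I :=
  exist _ [set val x \+ k | k in I]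
    (mem_set (ex_intro2 _ _ (val x) (set_mem (valP x)) erefl)).

(* The map X / I -> X' / I' induced by F: the coset C is sent to the coset that
   contains F(C).  The value c0 is only used when there is no such coset. *)
Definition induced (F : (V -> S) -> V' -> S') (c0 : quotient X' I')
    (C : quotient X I) : quotient X' I' :=
  xget c0 [set C' : quotient X' I' | F @` val C `<=` val C'].

End Cosets.

Section TorsionFree.
Variables (G : profiniteGroupType) (R S : comNzRingType).
Variable i : {rmorphism R -> S}.

Definition wmap0 (K : set G) : wmap K R :=
  @WMap _ K R (fun=> 0) (fun _ _ _ => erefl).

(* tau_S^K(W_K(R)) *)
Definition DeltaTF (K : set G) : set (ccl K -> S) :=
  [set tauQ (wmap_comp i a) | a in [set: wmap K R]].
Arguments DeltaTF : clear implicits.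

Definition APTF (K : set G) : set (ccl K -> S) := @thetaQ G S K @` DeltaTF K.
Arguments APTF : clear implicits.

Definition tauTF (K : set G) (a : wmap K R) : DeltaTF K :=
  exist _ (tauQ (wmap_comp i a)) (mem_set (imageP _ I)).

Definition thetaTF (K : set G) (x : DeltaTF K) : APTF K :=
  exist _ (thetaQ (val x)) (mem_set (imageP _ (set_mem (valP x)))).

(* Restrictions of [ResQ] and [bResQ]: the default value is only used outside
   of the preimage of the codomain. *)
Definition ResTF (K U : set G) (x : DeltaTF K) : DeltaTF U :=
  insubd (tauTF (wmap0 U)) (ResQ K U (val x)).

Definition bResTF (h : {rmorphism rat -> S}) (K U : set G) (x : APTF K) :
    APTF U :=
  insubd (thetaTF (tauTF (wmap0 U))) (bResQ h K U (val x)).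

End TorsionFree.

Arguments DeltaTF {G R S} i K _.
Arguments APTF {G R S} i K _.

Section Torsion.
Variables (G : profiniteGroupType) (R R' S : comNzRingType).
Variables (rho : {rmorphism R' -> R}) (i : {rmorphism R' -> S}).

(* W_K(ker rho) *)
Definition wker (K : set G) : set (wmap K R') :=
  [set a | forall V, rho (a V) = 0].
Arguments wker : clear implicits.

Definition DeltaKer (K : set G) : set (ccl K -> S) :=
  [set tauQ (wmap_comp i a) | a in wker K].
Arguments DeltaKer : clear implicits.

Definition APKer (K : set G) : set (ccl K -> S) := @thetaQ G S K @` DeltaKer K.
Arguments APKer : clear implicits.

Definition DeltaT (K : set G) := quotient (DeltaTF i K) (DeltaKer K).
Definition APT (K : set G) := quotient (APTF i K) (APKer K).
Arguments DeltaT : clear implicits.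
Arguments APT : clear implicits.

Definition DeltaT0 (K : set G) : DeltaT K :=
  coset (DeltaKer K) (tauTF i (wmap0 R' K)).
Definition APT0 (K : set G) : APT K :=
  coset (APKer K) (thetaTF (tauTF i (wmap0 R' K))).

(* The map induced by [tauTF] on W_K(R) = W_K(R') / W_K(ker rho), this
   identification being the one given by W_K(rho). *)
Definition tauT (K : set G) (a : wmap K R) : DeltaT K :=
  xget (DeltaT0 K) [set C : DeltaT K | forall a' : wmap K R',
    wmap_comp rho a' = a -> val C (val (tauTF i a'))].

Definition thetaT (K : set G) : DeltaT K -> APT K :=
  induced (@thetaQ G S K) (APT0 K).

Definition ResT (K U : set G) : DeltaT K -> DeltaT U :=
  induced (ResQ K U) (DeltaT0 U).

Definition bResT (h : {rmorphism rat -> S}) (K U : set G) : APT K -> APT U :=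
  induced (bResQ h K U) (APT0 U).

End Torsion.

Arguments DeltaT {G R R' S} rho i K _.
Arguments APT {G R R' S} rho i K _.

Definition Delta (G : profiniteGroupType) (R : comNzRingType)
    (c : coef_case R) (K : set G) : Type :=
  match c with
  | ContainsQ _ => ccl K -> R
  | TorsionFree _ i _ _ _ _ => DeltaTF i K
  | Torsion _ _ rho i _ _ _ _ _ => DeltaT rho i K
  end.

Definition AP (G : profiniteGroupType) (R : comNzRingType)
    (c : coef_case R) (K : set G) : Type :=
  match c with
  | ContainsQ _ => ccl K -> R
  | TorsionFree _ i _ _ _ _ => APTF i K
  | Torsion _ _ rho i _ _ _ _ _ => APT rho i K
  end.

Section Maps.
Variables (G : profiniteGroupType) (R : comNzRingType).

Definition tau (c : coef_case R) (K : set G) : wmap K R -> Delta c K :=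
  match c return wmap K R -> Delta c K with
  | ContainsQ _ => @tauQ G R K
  | TorsionFree _ i _ _ _ _ => @tauTF G R _ i K
  | Torsion _ _ rho i _ _ _ _ _ => @tauT G R _ _ rho i K
  end.

Definition theta (c : coef_case R) (K : set G) : Delta c K -> AP c K :=
  match c return Delta c K -> AP c K with
  | ContainsQ _ => @thetaQ G R K
  | TorsionFree _ i _ _ _ _ => @thetaTF G R _ i K
  | Torsion _ _ rho i _ _ _ _ _ => @thetaT G R _ _ rho i K
  end.

Definition gamma (c : coef_case R) (K : set G) : wmap K R -> AP c K :=
  @theta c K \o tau c (K := K).

Definition Res (c : coef_case R) (K U : set G) : Delta c K -> Delta c U :=
  match c return Delta c K -> Delta c U with
  | ContainsQ _ => @ResQ G R K U
  | TorsionFree _ i _ _ _ _ => @ResTF G R _ i K U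
  | Torsion _ _ rho i _ _ _ _ _ => @ResT G R _ _ rho i K U
  end.

Definition bRes (c : coef_case R) (K U : set G) : AP c K -> AP c U :=
  match c return AP c K -> AP c U with
  | ContainsQ h => @bResQ G R h K U
  | TorsionFree _ i h _ _ _ => @bResTF G R _ i h K U
  | Torsion _ _ rho i h _ _ _ _ => @bResT G R _ _ rho i h K U
  end.

End Maps.

Arguments tau {G R} c K _.
Arguments theta {G R} c K _.
Arguments gamma {G R} c K _.
Arguments Res {G R} c K U _.
Arguments bRes {G R} c K U _.

(* Main.v *)
(* Write Phi_X(b) = sum'_V phi_X(K/V) b_V for the mark at X of a family b indexed
   by the conjugacy classes of open subgroups of K.  Over a ring containing Q, a
   family is determined by its marks, by triangularity for the index.  Two
   countings of fixed points, along G/V -> G/U and along the orbits of U on G/V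
   (Mackey), give Phi_X(tau a) = phi_X(a) and Phi_X(Res b) = Phi_X(b), so that
   (a) over a Q-algebra reduces to the identity defining f_U.  Over a general
   ring, it remains to see that the zero of W_K(A) is the zero map (the phi_X
   are jointly injective at 0 over Z), which makes Delta_K(ker rho) an additive
   subgroup preserved by Res. *)
Require Import Defs.
From HB Require Import structures.
From mathcomp Require Import all_boot all_order all_algebra finmap.
From mathcomp Require Import all_classical topology.

Set Implicit Arguments.
Unset Strict Implicit.
Unset Printing Implicit Defensive.

Import Order.TTheory GRing.Theory Num.Theory.

Local Open Scope classical_set_scope.
Local Open Scope ring_scope.

(** The ring structure on W_K(A) and the family f_U are known only through naturality and ghost
    components, and over a ring A with torsion these components need not determine an element. Hence
    the zero of W_K(A) and the value f_U(0) are both settled over Z and carried to A along Z -> A by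
    naturality. This makes W_K(ker rho) the kernel of W_K(rho), so that two lifts to R' of one
    element of W_K(R) differ by an element of it. That Res preserves the families coming from R
    inside those over R (x) Q is itself a consequence of (a) over R (x) Q: the equality Res(tau a) =
    tau(f_U a) exhibits the value as an element of Delta_U(R). The default values in the definitions
    of the restricted maps are thus never reached. The formula behind (b) is a cancellation: the
    factor (U:W)/(K:V) of bold Res absorbs the (K:V) of theta on K and leaves the (U:W) of theta on
    U. Composing (a) and (b) gives (c). *)

Section FiniteSums.

(** * Finite sums and cardinals *)

Lemma card_fsum (T : choiceType) (A : set T) : finite_set A ->
  (\sum_(x \in A) 1 = #|` fset_set A| :> nat)%N.
Proof. by move=> fA; rewrite fsbig_finite// card_fset_sum1. Qed.

Lemma card_fset_set_bij (T T' : choiceType) (A : set T) (B : set T')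
    (f : T -> T') (g : T' -> T) : finite_set A -> finite_set B ->
  (forall x, A x -> B (f x)) -> (forall y, B y -> A (g y)) ->
  (forall x, A x -> g (f x) = x) -> (forall y, B y -> f (g y) = y) ->
  #|` fset_set A| = #|` fset_set B|.
Proof.
move=> fA fB AB BA gf fg; rewrite -!card_fsum//.
rewrite (reindex_fsbig f A)//; split => //.
- by move=> x y /set_mem Ax /set_mem Ay fxy; rewrite -(gf _ Ax) fxy gf.
- by move=> y By; exists (g y); [exact: BA | exact: fg].
Qed.

Lemma fsum_const (V : nmodType) (T : choiceType) (A : set T) (r : V) :
  finite_set A -> \sum_(x \in A) r = r *+ #|` fset_set A|.
Proof.
by move=> fA; rewrite fsbig_finite// big_const_seq count_predT iter_addr_0.
Qed.

Lemma fsumMnl (V : nmodType) (T : choiceType) (A : set T) (F : T -> V) n :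
  finite_set A -> \sum_(x \in A) (F x *+ n) = (\sum_(x \in A) F x) *+ n.
Proof. by move=> fA; rewrite !fsbig_finite// sumrMnl. Qed.

Lemma fsumMnr (V : nmodType) (T : choiceType) (A : set T) (r : V)
    (F : T -> nat) : finite_set A ->
  \sum_(x \in A) (r *+ F x) = r *+ (\sum_(x \in A) F x)%N.
Proof. by move=> fA; rewrite !fsbig_finite// sumrMnr. Qed.

Lemma fsum_partition (R : Type) (idx : R) (op : Monoid.com_law idx)
    (I J : choiceType) (A : set I) (B : set J) (r : I -> J -> Prop)
    (F : I -> R) : finite_set A -> finite_set B ->
  (forall i, A i -> exists2 j, B j & r i j) ->
  (forall i j j', A i -> B j -> B j' -> r i j -> r i j' -> j = j') ->
  \big[op/idx]_(i \in A) F i =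
  \big[op/idx]_(j \in B) \big[op/idx]_(i \in [set i | A i /\ r i j]) F i.
Proof.
move=> fA fB rex runi.
transitivity (\big[op/idx]_(i \in A) \big[op/idx]_(j \in B)
   if i \in [set i | r i j] then F i else idx).
  apply: eq_fsbigr => i /set_mem Ai; have [j Bj rij] := rex _ Ai.
  rewrite (fsbigD1 j)//= mem_set// fsbig1 ?Monoid.mulm1// => j' [Bj' nj].
  case: ifPn => // /set_mem rij'; case: nj; exact: (runi i).
rewrite exchange_fsbig//; apply: eq_fsbigr => j _.
by rewrite -fsbig_mkcondr.
Qed.

Lemma fsum_sub (R : Type) (idx : R) (op : Monoid.com_law idx)
    (I : choiceType) (A B : set I) (F : I -> R) : A `<=` B ->
  (forall i, B i -> ~ A i -> F i = idx) ->
  \big[op/idx]_(i \in A) F i = \big[op/idx]_(i \in B) F i.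
Proof. by move=> AB z; apply: fsbig_widen => // i [Bi nAi]; exact: z. Qed.

End FiniteSums.

Arguments fsum_partition {R idx op I J} A B r F.
Arguments fsum_sub {R idx op I} A B F.

(** * Cosets, indices and fixed points on coset spaces *)

Definition open_subgroup (G : profiniteGroupType) (A : set G) : Prop :=
  [/\ A 1%g, forall x y, A x -> A y -> A (x * y)%g,
      forall x, A x -> A x^-1%g & open A].

Section Subgroups.
Local Open Scope group_scope.
Variable G : profiniteGroupType.
Implicit Types (g k x : G) (K U V W X : set G).

Lemma open_subgroupT : open_subgroup [set: G].
Proof. by split=> //; exact: openT. Qed.

Lemma osubgroupP K (V : osubgroup K) : open_subgroup V.
Proof. by case: V => V ? ? ? ? ?; split. Qed.

Lemma osubgroup_eq K (V V' : osubgroup K) : V = V' :> set G -> V = V'.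
Proof.
case: V V' => [V a b c d e] [V' a' b' c' d' e'] /= E; move: a' b' c' d' e'.
rewrite -E => a' b' c' d' e'.
by congr OSubgroup; exact: Prop_irrelevance.
Qed.

Definition mk_osubgroup K V (hV : open_subgroup V) (VK : V `<=` K) :
    osubgroup K :=
  let: And4 h1 hM hI hO := hV in OSubgroup VK h1 hM hI hO.

Lemma mk_osubgroupE K V (hV : open_subgroup V) (VK : V `<=` K) :
  mk_osubgroup hV VK = V :> set G.
Proof. by case: hV. Qed.

Lemma lcosetE g V x : lcoset g V x = V (g^-1 * x)%g.
Proof.
apply/propext; split => [[v Vv <-]|Vx]; first by rewrite mulKg.
by exists (g^-1 * x)%g => //; rewrite mulVKg.
Qed.

Lemma conjsetE g V x : conjset g V x = V (g^-1 * x * g)%g.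
Proof.
apply/propext; split => [[v Vv <-]|Vx].
  by rewrite !mulgA mulVg mul1g mulgVK.
by exists (g^-1 * x * g)%g => //; rewrite !mulgA mulgV mul1g mulgK.
Qed.

Lemma lcosetM g k V : lcoset g (lcoset k V) = lcoset (g * k)%g V.
Proof. by apply/seteqP; split => x; rewrite !lcosetE invgM mulgA. Qed.

Lemma lcoset1 V : lcoset 1%g V = V.
Proof. by apply/seteqP; split => x; rewrite !lcosetE invg1 mul1g. Qed.

Lemma lcosetK g V : lcoset g^-1 (lcoset g V) = V.
Proof. by rewrite lcosetM mulVg lcoset1. Qed.

Lemma lcosetKV g V : lcoset g (lcoset g^-1 V) = V.
Proof. by rewrite lcosetM mulgV lcoset1. Qed.

Lemma lcosetS g V W : V `<=` W -> lcoset g V `<=` lcoset g W.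
Proof. by move=> VW x; rewrite !lcosetE => /VW. Qed.

Lemma conjsetM g k V : conjset g (conjset k V) = conjset (g * k)%g V.
Proof. by apply/seteqP; split => x; rewrite !conjsetE invgM !mulgA. Qed.

Lemma conjset1 V : conjset 1%g V = V.
Proof. by apply/seteqP; split => x; rewrite !conjsetE invg1 mul1g mulg1. Qed.

Lemma conjsetK g V : conjset g^-1 (conjset g V) = V.
Proof. by rewrite conjsetM mulVg conjset1. Qed.

Lemma conjsetKV g V : conjset g (conjset g^-1 V) = V.
Proof. by rewrite conjsetM mulgV conjset1. Qed.

Lemma conjsetS g V W : V `<=` W -> conjset g V `<=` conjset g W.
Proof. by move=> VW x; rewrite !conjsetE => /VW. Qed.

Lemma conjset_subl g V W : (conjset g V `<=` W) = (V `<=` conjset g^-1 W).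
Proof.
apply/propext; split => /(@conjsetS _ _ _) h.
  by rewrite -{1}(conjsetK g V); exact: h.
by rewrite -(conjsetKV g W); exact: h.
Qed.

Lemma conjset_in K g V : open_subgroup K -> K g -> V `<=` K ->
  conjset g V `<=` K.
Proof.
move=> [_ KM KV _] Kg VK x [v /VK Kv <-].
by apply: (KM); [exact: KM | exact: KV].
Qed.

Lemma lcoset_eqP g k V : open_subgroup V ->
  (lcoset g V = lcoset k V) <-> V (g^-1 * k)%g.
Proof.
move=> [V1 VM VV _]; split => [E|h].
  by rewrite -lcosetE E lcosetE mulVg.
apply/seteqP; split => x; rewrite !lcosetE => Vx.
  have -> : (k^-1 * x = (g^-1 * k)^-1 * (g^-1 * x))%g.
    by rewrite invgM invgK !mulgA mulgK.
  by apply: (VM) => //; exact: VV.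
have -> : (g^-1 * x = (g^-1 * k) * (k^-1 * x))%g by rewrite !mulgA mulgK.
exact: VM.
Qed.

Lemma lcoset_refl g V : open_subgroup V -> lcoset g V g.
Proof. by move=> [V1 _ _ _]; rewrite lcosetE mulVg. Qed.

Lemma lcoset_eq g k V : open_subgroup V -> lcoset g V k ->
  lcoset g V = lcoset k V.
Proof. by move=> hV; rewrite lcosetE => /lcoset_eqP; exact. Qed.

Lemma continuous_mulgl g : continuous (fun x : G => (g * x)%g).
Proof.
move=> x; apply: (@continuous2_cvg _ _ _ _ _ _ (fun=> g) id
  (fun a b : G => a * b)) => //; last exact: cvg_cst.
exact: (@mulg_continuous G (g, x)).
Qed.

Lemma continuous_mulgr g : continuous (fun x : G => (x * g)%g).
Proof.
move=> x; apply: (@continuous2_cvg _ _ _ _ _ _ id (fun=> g)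
  (fun a b : G => a * b)) => //; last exact: cvg_cst.
exact: (@mulg_continuous G (x, g)).
Qed.

Lemma lcoset_open g V : open V -> open (lcoset g V).
Proof.
move=> oV; rewrite (_ : lcoset g V = (fun x => g^-1 * x)%g @^-1` V).
  by apply: open_comp => // x _; exact: continuous_mulgl.
by apply/seteqP; split => x; rewrite lcosetE.
Qed.

Lemma conjset_open g V : open V -> open (conjset g V).
Proof.
move=> oV; rewrite (_ : conjset g V =
  (fun x => g^-1 * x)%g @^-1` ((fun x => x * g)%g @^-1` V)).
  apply: open_comp => [x _|]; first exact: continuous_mulgl.
  by apply: open_comp => // x _; exact: continuous_mulgr.
by apply/seteqP; split => x; rewrite conjsetE.
Qed.

Lemma open_subgroupJ g V : open_subgroup V -> open_subgroup (conjset g V).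
Proof.
move=> [V1 VM VV Vo]; split; last exact: conjset_open.
- by rewrite conjsetE mulg1 mulVg.
- move=> x y; rewrite !conjsetE => Vx Vy.
  have -> : (g^-1 * (x * y) * g = (g^-1 * x * g) * (g^-1 * y * g))%g.
    by rewrite !mulgA mulgK.
  exact: VM.
- move=> x; rewrite !conjsetE => /VV; by rewrite !invgM invgK !mulgA.
Qed.

Lemma open_subgroupI V W : open_subgroup V -> open_subgroup W ->
  open_subgroup (V `&` W).
Proof.
move=> [V1 VM VV Vo] [W1 WM WV Wo]; split => //; last exact: openI.
- by move=> x y [? ?] [? ?]; split; [exact: VM | exact: WM].
- by move=> x [? ?]; split; [exact: VV | exact: WV].
Qed.

(** By compactness finitely many of the open cosets of V cover G, and kV equals any member of the
    cover that contains k. *)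
Lemma lcosets_finite K V : open_subgroup V -> finite_set (lcosets K V).
Proof.
move=> hV; have [V1 _ _ Vo] := hV.
(* [compact_cover] is stated for pointed spaces; the base point is 1. *)
pose pG : ptopologicalType :=
  HB.pack_for ptopologicalType (G : Type) (Topological.class G)
    (isPointed.Build G 1).
have : @compact pG setT := @profinite_compact G; rewrite compact_cover.
move=> /(_ _ [set: G] (fun g => lcoset g V)).
case=> [g _|g _|D _ DG]; first exact: lcoset_open.
  by exists g => //; exact: lcoset_refl.
apply: sub_finite_set (finite_image (fun g => lcoset g V) (finite_fset D)).
move=> _ [k _ <-]; have [d /= dD hd] := DG k I.
by exists d => //; exact: lcoset_eq.
Qed.

Definition fixcosets X K V : set (set G) := [set C | lcosets K V C /\
  forall u, X u -> [set (u * x)%g | x in C] = C].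

Lemma fixptsE X K V : fixpts X K V = #|` fset_set (fixcosets X K V)|.
Proof. by []. Qed.

Lemma fixcosetsP X K V C : open_subgroup V -> fixcosets X K V C <->
  exists k, [/\ K k, C = lcoset k V & X `<=` conjset k V].
Proof.
move=> hV; have [_ _ VV _] := hV; split.
  move=> [[k Kk <-] h]; exists k; split => // u /h.
  rewrite -/(lcoset u (lcoset k V)) lcosetM => /lcoset_eqP - /(_ hV) /VV.
  by rewrite invgM invgK conjsetE mulgA.
move=> [k [Kk -> h]]; split; first by exists k.
move=> u /h; rewrite -/(lcoset u (lcoset k V)) lcosetM => hu.
apply/lcoset_eqP => //; move: hu; rewrite conjsetE => /VV.
by rewrite !invgM invgK mulgA.
Qed.

Lemma fixcosets_coset X K V C g : open_subgroup V -> fixcosets X K V C -> C g ->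
  C = lcoset g V /\ X `<=` conjset g V.
Proof.
move=> hV [[k Kk <-] h] Cg; split; first exact: lcoset_eq.
move=> u /h E; have : lcoset k V (u * g)%g.
  by rewrite -E; exists g.
by rewrite (lcoset_eq hV Cg) lcosetE conjsetE mulgA.
Qed.

Lemma fixcosets_finite X K V : open_subgroup V -> finite_set (fixcosets X K V).
Proof. by move=> hV; apply: sub_finite_set (lcosets_finite K hV) => C []. Qed.

(** Indices thereby inherit the conjugation and tower formulas of fixed-point counts, as the case X
    = [set0]. *)
Lemma gindexE K V : gindex K V = fixpts set0 K V.
Proof.
rewrite fixptsE; congr (#|` fset_set _|); apply/seteqP; split => C; last by case.
by move=> h; split.
Qed.

Lemma conjset0 g : conjset g set0 = set0 :> set G.
Proof. by rewrite /conjset image_set0. Qed.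

Lemma fixpts_conjl k X K V : open_subgroup K -> open_subgroup V -> K k ->
  fixpts (conjset k X) K V = fixpts X K V.
Proof.
move=> [_ KM KV _] hV Kk; rewrite !fixptsE.
apply: (card_fset_set_bij (f := lcoset k^-1) (g := lcoset k));
  try exact: fixcosets_finite.
- move=> C /fixcosetsP [//|h [Kh -> Xh]]; apply/fixcosetsP => //.
  exists (k^-1 * h)%g; rewrite lcosetM; split => //; first by apply/KM/Kh/KV.
  by rewrite -conjsetM -conjset_subl.
- move=> C /fixcosetsP [//|h [Kh -> Xh]]; apply/fixcosetsP => //.
  exists (k * h)%g; rewrite lcosetM; split => //; first by apply/KM.
  by rewrite -conjsetM conjset_subl conjsetK.
- by move=> C _; rewrite lcosetKV.
- by move=> C _; rewrite lcosetK.
Qed.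

Definition rcoset g V : set G := [set (v * g)%g | v in V].

Lemma rcosetE g V x : rcoset g V x = V (x * g^-1)%g.
Proof.
apply/propext; split => [[v Vv <-]|Vx]; first by rewrite mulgK.
by exists (x * g^-1)%g => //; rewrite mulgVK.
Qed.

Lemma rcosetK g V : rcoset g^-1 (rcoset g V) = V.
Proof. by apply/seteqP; split => x; rewrite !rcosetE invgK mulgK. Qed.

Lemma rcosetKV g V : rcoset g (rcoset g^-1 V) = V.
Proof. by apply/seteqP; split => x; rewrite !rcosetE invgK mulgVK. Qed.

Lemma rcoset_lcoset g k V : rcoset g^-1 (lcoset k V) =
  lcoset (k * g^-1)%g (conjset g V).
Proof.
apply/seteqP; split => x; rewrite rcosetE !lcosetE conjsetE invgM !invgK !mulgA.
  by rewrite mulVg mul1g.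
by rewrite mulVg mul1g.
Qed.

(** Right translation by k^-1 is an isomorphism of K-sets from K/V to K/kVk^-1, because hVk^-1 =
    hk^-1(kVk^-1). *)
Lemma fixpts_conjr k X K V : open_subgroup K -> open_subgroup V -> K k ->
  fixpts X K (conjset k V) = fixpts X K V.
Proof.
move=> [_ KM KV _] hV Kk; rewrite !fixptsE.
have hkV := open_subgroupJ k hV.
apply: (card_fset_set_bij (f := rcoset k) (g := rcoset k^-1));
  try exact: fixcosets_finite.
- move=> C /fixcosetsP [//|h [Kh -> Xh]]; apply/fixcosetsP => //.
  exists (h * k)%g; split; [exact: KM| |by rewrite -conjsetM].
  by rewrite -{1}(invgK k) rcoset_lcoset invgK conjsetK.
- move=> C /fixcosetsP [//|h [Kh -> Xh]]; apply/fixcosetsP => //.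
  exists (h * k^-1)%g; split; first by apply/KM/KV.
    exact: rcoset_lcoset.
  by rewrite conjsetM mulgVK.
- by move=> C _; rewrite rcosetK.
- by move=> C _; rewrite rcosetKV.
Qed.

Lemma gindex_conjr k K V : open_subgroup K -> open_subgroup V -> K k ->
  gindex K (conjset k V) = gindex K V.
Proof. by move=> hK hV Kk; rewrite !gindexE fixpts_conjr. Qed.

Definition crep (C : set G) : G := xget 1%g C.

Lemma crepP C g : C g -> C (crep C).
Proof. exact: xgetI. Qed.

(* The fibre over gU of the map G/V -> G/U is g(U/V), on which X acts as
   g^-1Xg acts on U/V. *)
Lemma fixpts_tower X K U V : open_subgroup K -> open_subgroup U ->
    open_subgroup V -> U `<=` K -> V `<=` U ->
  fixpts X K V =
  (\sum_(C \in fixcosets X K U) fixpts (conjset (crep C)^-1 X) U V)%N.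
Proof.
move=> [_ KM KV _] hU hV UK VU; have [U1 UM UV _] := hU.
rewrite fixptsE -card_fsum; last exact: fixcosets_finite.
rewrite (fsum_partition _ (fixcosets X K U) (fun D C => D `<=` C));
  try exact: fixcosets_finite.
- apply: eq_fsbigr => C /set_mem fC; rewrite card_fsum; last first.
    apply: sub_finite_set (fixcosets_finite X K hV) => D [] //.
  set g := crep C.
  have Cg : C g.
    by rewrite /g; case: fC => [[k _ <-] _]; exact: (crepP (lcoset_refl k hU)).
  have [CE XC] := fixcosets_coset hU fC Cg.
  have Kg : K g.
    case: fC => [[k Kk E] _]; move: Cg; rewrite -E => -[u /UK Ku <-].
    exact: KM.
  rewrite fixptsE; apply: (card_fset_set_bij (f := lcoset g^-1) (g := lcoset g)).
  + by apply: sub_finite_set (fixcosets_finite X K hV) => D [].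
  + exact: fixcosets_finite.
  + move=> D [/fixcosetsP [//|k [Kk -> Xk]]] kC; apply/fixcosetsP => //.
    exists (g^-1 * k)%g; rewrite lcosetM; split => //.
      by rewrite -lcosetE -CE; apply: kC; exact: lcoset_refl.
    by rewrite -conjsetM; exact: conjsetS.
  + move=> D /fixcosetsP [//|k [Uk -> Xk]]; split; last first.
      rewrite CE; apply: lcosetS => x; rewrite lcosetE => /VU.
      by move=> /(UM _ _ Uk); rewrite mulVKg.
    apply/fixcosetsP => //; exists (g * k)%g; rewrite lcosetM; split => //.
      by apply: (KM) => //; exact: UK.
    by move/(conjsetS (g := g)): Xk; rewrite conjsetKV conjsetM.
  + by move=> D _; rewrite lcosetKV.
  + by move=> D _; rewrite lcosetK.
- move=> D /fixcosetsP [//|k [Kk -> Xk]]; exists (lcoset k U).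
    apply/fixcosetsP => //; exists k; split => //.
    by apply: subset_trans Xk _; exact: conjsetS.
  exact: lcosetS.
- move=> D C C' /fixcosetsP [//|k [Kk -> Xk]] fC fC' DC DC'.
  have kk := lcoset_refl k hV.
  rewrite (fixcosets_coset hU fC (DC _ kk)).1.
  by rewrite (fixcosets_coset hU fC' (DC' _ kk)).1.
Qed.

Lemma gindex_tower K U V : open_subgroup K -> open_subgroup U ->
    open_subgroup V -> U `<=` K -> V `<=` U ->
  gindex K V = (gindex K U * gindex U V)%N.
Proof.
move=> hK hU hV UK VU; rewrite !gindexE (fixpts_tower _ hK hU hV UK VU).
under eq_fsbigr do rewrite conjset0.
rewrite fsbig_finite; last exact: fixcosets_finite.
by rewrite big_const_seq count_predT iter_addn addn0 mulnC.
Qed.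

(* u(U n gVg^-1) |-> ugV *)
Lemma fixpts_dcoset X K U V g : open_subgroup K -> open_subgroup U ->
    open_subgroup V -> U `<=` K -> X `<=` U -> K g ->
  #|` fset_set [set C | fixcosets X K V C /\ C `<=` dcoset U g V]| =
  fixpts X U (Zset g U V).
Proof.
move=> [_ KM KV _] hU hV UK XU Kg; have [U1 UM UV _] := hU.
have [V1 VM VV _] := hV.
have hZ : open_subgroup (Zset g U V).
  by apply: open_subgroupI => //; exact: open_subgroupJ.
have conjZ u : U u -> X `<=` conjset (u * g)%g V -> X `<=` conjset u (Zset g U V).
  move=> Uu h x Xx; rewrite conjsetE; split.
    by apply: (UM) => //; apply: (UM); [exact: UV | exact: XU].
  by have := h _ Xx; rewrite -conjsetM conjsetE.
have fZ u : U u -> lcoset u (Zset g U V) =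
    [set x | U x /\ lcoset (u * g)%g V (x * g)%g].
  move=> Uu; apply/seteqP; split => x; rewrite /= !lcosetE /Zset/= conjsetE;
    rewrite invgM !mulgA; (move=> -[] h1 h2; split) => //.
    by have := UM _ _ Uu h1; rewrite mulVKg.
  by apply: (UM) => //; exact: UV.
rewrite fixptsE; apply: (card_fset_set_bij
  (f := fun C => [set u | U u /\ C (u * g)%g])
  (g := fun C => [set x | exists2 u, C u & lcoset (u * g)%g V x])).
- by apply: sub_finite_set (fixcosets_finite X K hV) => D [].
- exact: fixcosets_finite.
- move=> C [/fixcosetsP [//|k [Kk -> Xk]]] kC; apply/fixcosetsP => //.
  have [u Uu [v Vv E]] := kC _ (lcoset_refl k hV).
  have E' : lcoset k V = lcoset (u * g)%g V.
    by symmetry; apply: lcoset_eq => //; exists v.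
  exists u; split => //; first by rewrite E' fZ.
  apply: conjZ => // x /Xk; rewrite E !conjsetE => h.
  have -> : ((u * g)^-1 * x * (u * g) =
     v * ((u * g * v)^-1 * x * (u * g * v)) * v^-1)%g.
    by rewrite !invgM !mulgA mulgV mul1g mulgK.
  by apply: (VM); [exact: VM | exact: VV].
- move=> C /fixcosetsP [//|k [Uk -> Xk]].
  have -> : [set x | exists2 u, lcoset k (Zset g U V) u & lcoset (u * g)%g V x]
      = lcoset (k * g)%g V.
    apply/seteqP; split => x.
      by move=> [u]; rewrite fZ// => -[Uu /lcoset_eq ->].
    by move=> h; exists k => //; exact: lcoset_refl.
  split; last by move=> _ [v Vv <-]; exists k => //; exists v.
  apply/fixcosetsP => //; exists (k * g)%g; split => //.
    by apply: (KM) => //; exact: UK.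
  by move=> x /Xk; rewrite conjsetE => -[_ h]; rewrite -conjsetM conjsetE.
- move=> C [/fixcosetsP [//|k [Kk -> Xk]]] kC.
  have [u Uu [v Vv E]] := kC _ (lcoset_refl k hV).
  have E' : lcoset k V = lcoset (u * g)%g V.
    by symmetry; apply: lcoset_eq => //; exists v.
  rewrite E'; apply/seteqP; split => x.
    by move=> [u' [Uu' /lcoset_eq ->]].
  by move=> h; exists u => //; split => //; exact: lcoset_refl.
- move=> C /fixcosetsP [//|k [Uk -> Xk]].
  rewrite [RHS]fZ//; apply/seteqP; split => x /=.
    by move=> [Ux [u]]; rewrite fZ// => -[Uu /lcoset_eq ->].
  by move=> [Ux h]; split => //; exists k => //; exact: lcoset_refl.
Qed.

Lemma gindex_gt0 K V : open_subgroup K -> open_subgroup V -> (0 < gindex K V)%N.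
Proof.
move=> [K1 _ _ _] hV; rewrite /gindex cardfs_gt0; apply/negP => /eqP E.
have : lcoset 1%g V \in fset_set (lcosets K V).
  by rewrite in_fset_set ?mem_set//; [exists 1%g | exact: lcosets_finite].
by rewrite E.
Qed.

Lemma gindex_le1 K V : open_subgroup K -> open_subgroup V ->
  (gindex K V <= 1)%N -> K `<=` V.
Proof.
move=> hK hV; have [K1 _ _ _] := hK => le1 x Kx.
have : gindex K V == 1%N by rewrite eqn_leq le1 gindex_gt0.
rewrite /gindex => /cardfs1P [C E].
have h y : K y -> lcoset y V = C.
  move=> Ky; have : lcoset y V \in fset_set (lcosets K V).
    by rewrite in_fset_set ?mem_set//; [exists y | exact: lcosets_finite].
  by rewrite E inE => /eqP.
have := lcoset_refl x hV; rewrite (h _ Kx) -(h _ K1).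
by rewrite lcosetE invg1 mul1g.
Qed.

Lemma fixpts_gt0 K V : open_subgroup K -> open_subgroup V -> V `<=` K ->
  (0 < fixpts V K V)%N.
Proof.
move=> [K1 _ _ _] hV VK; rewrite fixptsE cardfs_gt0; apply/negP => /eqP E.
have : lcoset 1%g V \in fset_set (fixcosets V K V).
  rewrite in_fset_set ?mem_set//; last exact: fixcosets_finite.
  by apply/fixcosetsP => //; exists 1%g; rewrite conjset1; split.
by rewrite E.
Qed.

(** By the tower formula (K:W) = (K:V)(kVk^-1:W), and the last factor is 1 only if W = kVk^-1. This
    is the triangularity behind every induction on the index. *)
Lemma gindex_lt K V W : open_subgroup K -> open_subgroup V ->
    open_subgroup W -> V `<=` K ->
  subconj K W V -> ~ conj_in K V W -> (gindex K V < gindex K W)%N.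
Proof.
move=> hK hV hW VK [k Kk WV] nVW; rewrite -(gindex_conjr hK hV Kk).
have hkV := open_subgroupJ k hV.
rewrite (gindex_tower hK hkV hW (conjset_in hK Kk VK) WV).
rewrite -{1}[gindex _ _]muln1 ltn_pmul2l ?gindex_gt0//.
rewrite ltnNge; apply/negP => le1; apply: nVW; exists k => //.
apply/seteqP; split => //; exact: gindex_le1.
Qed.

(** The definition picks some conjugate V' of V above X. Computing (K:X) through V', and (K:k^-1Xk)
    through V, gives (K:V')(V':X) = (K:V)(V:k^-1Xk), where (K:V') = (K:V) cancels. *)
Lemma index_conjE K V X k : open_subgroup K -> open_subgroup V ->
    open_subgroup X -> V `<=` K -> X `<=` conjset k V -> K k ->
  index_conj K V X = gindex V (conjset k^-1 X).
Proof.
move=> hK hV hX VK XV Kk; rewrite /index_conj.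
set V' := xget _ _.
have [[k' Kk' E] XV'] : [set V' | conj_in K V V' /\ X `<=` V'] V'.
  by apply: xgetPex; exists (conjset k V); split => //; exists k.
have hV' : open_subgroup V' by rewrite E; exact: open_subgroupJ.
have Kk1 : K k^-1%g by case: hK => _ _ h _; exact: h.
have hX' := open_subgroupJ k^-1 hX.
have XV1 : conjset k^-1 X `<=` V by rewrite conjset_subl invgK.
have := gindex_tower hK hV hX' VK XV1.
have V'K : V' `<=` K by rewrite E; exact: conjset_in.
rewrite gindex_conjr// (gindex_tower hK hV' hX V'K XV').
rewrite E (gindex_conjr hK)// => /eqP.
by rewrite eqn_pmul2l ?gindex_gt0// => /eqP.
Qed.

Lemma index_conj_gt0 K V X : open_subgroup K -> open_subgroup V ->
    open_subgroup X -> V `<=` K -> subconj K X V -> (0 < index_conj K V X)%N.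
Proof.
move=> hK hV hX VK [k Kk XV]; rewrite (index_conjE hK hV hX VK XV Kk).
by apply: gindex_gt0 => //; exact: open_subgroupJ.
Qed.

End Subgroups.

(** * Finiteness of open overgroups, and conjugacy classes *)

Lemma finite_powerset (T : choiceType) (A : set T) :
  finite_set A -> finite_set [set B | B `<=` A].
Proof.
move=> fA; apply: sub_finite_set (finite_image
  (fun B : {fset T} => [set` B]) (finite_fset (fpowerset (fset_set A)))).
move=> B BA; have fB : finite_set B := sub_finite_set BA fA.
exists (fset_set B); last by rewrite fset_setK.
by rewrite /= fpowersetE -fset_set_sub.
Qed.

(** The default value in [class_repr V] is V itself, so equality of the classes of V and V' does not
    yet identify their representatives. *)
Lemma xget_default (T : choiceType) (x y : T) (P : set T) :
  (exists z, P z) -> xget x P = xget y P.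
Proof.
rewrite /xget; case: pselect => // h [z Pz].
by case: h; exists z; apply/asboolP.
Qed.

(** V is recovered from the set V/X of cosets that it contains, which is a subset of the finite set
    G/X. *)
Lemma overgroups_finite (G : profiniteGroupType) (K X : set G) :
  open_subgroup X ->
  finite_set [set V : osubgroup K | X `<=` V].
Proof.
(* [V0] serves as the default value of [xget]; for an arbitrary set K the type [osubgroup K] may be
   empty. *)
move=> hX; case: (pselect (exists V0 : osubgroup K, X `<=` V0)) => [[V0 _]|nV];
  last by apply: sub_finite_set (finite_set0 _) => V XV; case: nV; exists V.
apply: sub_finite_set (finite_image
  (fun B => xget V0 [set V : osubgroup K | X `<=` V /\ lcosets V X = B])
  (finite_powerset (lcosets_finite [set: G] hX))).
move=> V XV; exists (lcosets V X); first by move=> _ [k _ <-]; exists k.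
set W := xget _ _; have [XW WV] : [set W : osubgroup K |
   X `<=` W /\ lcosets W X = lcosets V X] W by apply: xgetPex; exists V.
have h (A B : osubgroup K) : X `<=` A -> X `<=` B ->
    lcosets A X = lcosets B X -> A `<=` B.
  move=> XA XB E x Ax; have : lcosets A X (lcoset x X) by exists x.
  rewrite E => -[y By Exy]; have := lcoset_refl x hX.
  rewrite -Exy lcosetE => /XB h.
  by rewrite -(mulVKg y x); exact: osubgroupM.
by apply: osubgroup_eq; apply/seteqP; split; exact: h.
Qed.

Lemma conjsetI (G : profiniteGroupType) (g : G) (V W : set G) :
  conjset g (V `&` W) = conjset g V `&` conjset g W.
Proof. by apply/seteqP; split => x; rewrite !conjsetE /= !conjsetE. Qed.

Section Classes.
Local Open Scope group_scope.
Variable G : profiniteGroupType.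
Variable K : set G.
Hypothesis hK : open_subgroup K.
Implicit Types (V W X U : set G).

Lemma conj_in_refl V : conj_in K V V.
Proof. by case: hK => K1 _ _ _; exists 1; rewrite ?conjset1. Qed.

Lemma conj_in_sym V W : conj_in K V W -> conj_in K W V.
Proof.
case: hK => _ _ KV _ [k Kk ->]; exists k^-1; first exact: KV.
by rewrite conjsetK.
Qed.

Lemma conj_in_trans V W X : conj_in K V W -> conj_in K W X -> conj_in K V X.
Proof.
case: hK => _ KM _ _ [k Kk ->] [l Kl ->]; exists (l * k); first exact: KM.
by rewrite conjsetM.
Qed.

Lemma subconj_conjr X V W : conj_in K V W -> subconj K X V -> subconj K X W.
Proof.
case: hK => _ KM KV _ [k Kk ->] [l Kl XV]; exists (l * k^-1).
  by apply: (KM) => //; exact: KV.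
by rewrite conjsetM mulgVK.
Qed.

Lemma subconj_conjl X Y V : conj_in K X Y -> subconj K X V -> subconj K Y V.
Proof.
case: hK => _ KM KV _ [k Kk ->] [l Kl XV]; exists (k * l); first exact: KM.
by rewrite -conjsetM; exact: conjsetS.
Qed.

Lemma subconj_sub X V : X `<=` V -> subconj K X V.
Proof. by case: hK => K1 _ _ _; exists 1; rewrite ?conjset1. Qed.

Lemma subconj_trans X V W : subconj K X V -> subconj K V W -> subconj K X W.
Proof.
case: hK => _ KM _ _ [k Kk XV] [l Kl VW]; exists (k * l); first exact: KM.
by rewrite -conjsetM; apply: subset_trans XV _; exact: conjsetS.
Qed.

Lemma fixpts_eq0 X V : open_subgroup V -> ~ subconj K X V -> fixpts X K V = 0%N.
Proof.
move=> hV nXV; rewrite fixptsE (_ : fixcosets _ _ _ = set0) ?fset_set0 ?cardfs0//.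
apply/seteqP; split => // C /fixcosetsP [//|k [Kk _ Xk]].
by apply: nXV; exists k.
Qed.

Lemma class_reprP (V : osubgroup K) : conj_in K V (class_repr V).
Proof.
by apply: (@xgetPex _ V [set V' : osubgroup K | conj_in K V V']);
  exists V; exact: conj_in_refl.
Qed.

Lemma class_repr_eq (V V' : osubgroup K) : conj_in K V V' ->
  class_repr V = class_repr V'.
Proof.
move=> VV'; rewrite /class_repr.
rewrite (_ : [set V'0 : osubgroup K | conj_in K V V'0] =
             [set V'0 : osubgroup K | conj_in K V' V'0]).
  by apply: xget_default; exists V'; exact: conj_in_refl.
apply/seteqP; split => Y /=; last exact: conj_in_trans.
by apply: conj_in_trans; exact: conj_in_sym.
Qed.

Lemma ccl_ex (V : osubgroup K) : exists W : ccl K, conj_in K V (val W).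
Proof.
have cV : ccl K (class_repr V).
  by rewrite /ccl /=; symmetry; apply: class_repr_eq; exact: class_reprP.
exists (exist (fun V : osubgroup K => V \in ccl K) _ (mem_set cV)).
exact: class_reprP.
Qed.

Lemma ccl_uniq (V W : ccl K) : conj_in K (val V) (val W) -> V = W.
Proof.
move=> /class_repr_eq; have /set_mem := valP V; have /set_mem := valP W.
by rewrite /ccl /= => -> -> /val_inj.
Qed.

Lemma conjset_id x X : open_subgroup X -> X x -> conjset x X = X.
Proof.
move=> hX Xx; apply/seteqP; split; first exact: conjset_in.
rewrite -{1}(conjset1 X) -(mulgV x) -conjsetM; apply: conjsetS.
by apply: conjset_in => //; case: hX => _ _ h _; exact: h.
Qed.

(** The conjugate kXk^-1 depends only on the coset kX. *)
Lemma conjs_finite X : open_subgroup X ->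
  finite_set [set conjset k X | k in [set: G]].
Proof.
move=> hX; apply: sub_finite_set (finite_image
  (fun C => conjset (crep C) X) (lcosets_finite [set: G] hX)).
move=> _ [k _ <-]; exists (lcoset k X); first by exists k.
have [x Xx <-] := crepP (lcoset_refl k hX).
by rewrite -conjsetM (conjset_id hX Xx).
Qed.

(** X lies in kVk^-1 exactly when k^-1Xk lies in V; X has finitely many conjugates, each with
    finitely many open overgroups. Classes are taken in U but subconjugacy in K, as induction from U
    to K requires. *)
Lemma subconj_finite U X : open_subgroup X ->
  finite_set [set V : ccl U | subconj K X (val V)].
Proof.
move=> hX; rewrite (_ : [set V : ccl U | _] =
  val @^-1` [set V : osubgroup U | subconj K X V])//.
apply: finite_preimage; first by move=> V W _ _; exact: val_inj.
apply: sub_finite_set (bigcup_finite (conjs_finite hX)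
  (F := fun Y => [set V : osubgroup U | Y `<=` V]) _); last first.
  move=> _ [k _ <-]; apply: overgroups_finite; exact: open_subgroupJ.
move=> V [k Kk XV]; exists (conjset k^-1 X); first by exists k^-1.
by rewrite /= conjset_subl invgK.
Qed.

End Classes.

(** * Double cosets and the Mackey count *)

Section DoubleCosets.
Local Open Scope group_scope.
Variables (G : profiniteGroupType) (K U : set G).
Hypotheses (hK : open_subgroup K) (hU : open_subgroup U) (UK : U `<=` K).
Implicit Types (V X : set G) (g k : G).

Lemma dcoset_sub g k V : open_subgroup V -> dcoset U g V k ->
  dcoset U k V `<=` dcoset U g V.
Proof.
move=> [_ VM _ _]; have [_ UM _ _] := hU.
move=> [u Uu [v Vv ->]] _ [u' Uu' [v' Vv' ->]].
by exists (u' * u); [exact: UM|exists (v * v'); [exact: VM|rewrite !mulgA]].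
Qed.

Lemma dcoset_eq g k V : open_subgroup V -> dcoset U g V k ->
  dcoset U k V = dcoset U g V.
Proof.
move=> hV h; apply/seteqP; split; apply: dcoset_sub => //.
have [_ _ VV _] := hV; have [_ _ UV _] := hU.
case: h => u Uu [v Vv ->]; exists u^-1; first exact: UV.
by exists v^-1; [exact: VV | rewrite !mulgA mulVg mul1g mulgK].
Qed.

(** For k = ugv one has Z(k, U, V) = u Z(g, U, V) u^-1, so the U-class of Z(g, U, V) depends only on
    the double coset. *)
Lemma Zset_dcoset g k V : open_subgroup V -> dcoset U g V k ->
  conj_in U (Zset g U V) (Zset k U V).
Proof.
move=> hV [u Uu [v Vv ->]]; exists u => //; rewrite /Zset.
have -> : conjset (u * g * v) V = conjset u (conjset g V).
  by rewrite conjsetM -[in LHS]conjsetM (conjset_id hV Vv).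
by rewrite conjsetI (conjset_id hU Uu).
Qed.

Lemma open_subgroupZ g V : open_subgroup V -> open_subgroup (Zset g U V).
Proof. by move=> hV; apply: open_subgroupI => //; exact: open_subgroupJ. Qed.

Lemma dcosets_finite V W : open_subgroup V -> finite_set (dcosets K U V W).
Proof.
move=> hV; apply: sub_finite_set (finite_image
  (fun C => dcoset U (crep C) V) (lcosets_finite K hV)).
move=> _ [g [Kg -> _]]; exists (lcoset g V); first by exists g.
apply: dcoset_eq => //; have [v Vv <-] := crepP (lcoset_refl g hV).
by exists 1; [case: hU | exists v; rewrite ?mul1g].
Qed.

(** With X = W, a nonzero term of [ResQ] or [bResQ] at W forces W into a K-conjugate of V; the sums
    over all V are therefore finite. *)
Lemma dcosets_subconj X V W : open_subgroup V -> subconj U X W ->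
  dcosets K U V W !=set0 -> subconj K X V.
Proof.
move=> hV [u Uu XW] [_ [g [Kg _ [k Uk WE]]]].
have [_ KM _ _] := hK.
exists (u * k * g); first by apply: (KM) => //; apply: (KM); exact: UK.
apply: subset_trans XW _; rewrite WE -!conjsetM.
by do 2!apply: conjsetS; move=> ? [].
Qed.

(** As a U-set, the orbit of gV in K/V is U/Z(g, U, V). The X-fixed cosets are sorted by the class W
    of this stabilizer, then by orbit, and each orbit of class W contains phi_X(U/W) of them. *)
Lemma fixpts_Mackey X V : open_subgroup X -> open_subgroup V -> X `<=` U ->
  fixpts X K V = (\sum_(W \in [set W : ccl U | subconj U X (val W)])
    (#|` fset_set (dcosets K U V (val W))| * fixpts X U (val W)))%N.
Proof.
move=> hX hV XU; have [_ KM KV _] := hK.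
rewrite fixptsE -card_fsum; last exact: fixcosets_finite.
have Cg C : fixcosets X K V C -> C !=set0.
  by move=> [[k _ <-] _]; exists k; exact: lcoset_refl.
rewrite (fsum_partition _ [set W : ccl U | subconj U X (val W)]
  (fun C W => exists2 D, dcosets K U V (val W) D & C `<=` D)).
- apply: eq_fsbigr => W _.
  rewrite (fsum_partition _ (dcosets K U V (val W)) (fun C D => C `<=` D)).
  + transitivity (\sum_(D \in dcosets K U V (val W)) fixpts X U (val W))%N;
      last first.
      rewrite fsbig_finite; last exact: dcosets_finite.
      by rewrite big_const_seq count_predT iter_addn addn0 mulnC.
    apply: eq_fsbigr => D /set_mem dD; have [g [Kg DE gW]] := dD.
    rewrite card_fsum; last first.
      by apply: sub_finite_set (fixcosets_finite X K hV) => C [[]].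
    transitivity (fixpts X U (Zset g U V)); last first.
      case: gW => k Uk ->; rewrite fixpts_conjr//; exact: open_subgroupZ.
    rewrite -(fixpts_dcoset hK hU hV UK XU Kg) -DE.
    congr #|` fset_set _|; apply/seteqP; split => C /=; first by move=> [[]].
    by move=> [? ?]; split => //; split => //; exists D.
  + by apply: sub_finite_set (fixcosets_finite X K hV) => C [].
  + exact: dcosets_finite.
  + by move=> C [].
  + move=> C _ _ [/Cg[x Cx] _] [g [_ -> _]] [g' [_ -> _]] CD CD'.
    by rewrite -(dcoset_eq hV (CD _ Cx)) (dcoset_eq hV (CD' _ Cx)).
- exact: fixcosets_finite.
- exact: subconj_finite.
- move=> C /fixcosetsP [//|k [Kk -> Xk]].
  have hZ := open_subgroupZ k hV.
  have ZU : Zset k U V `<=` U by move=> ? [].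
  have [W] := ccl_ex hU (mk_osubgroup hZ ZU); rewrite mk_osubgroupE => ZW.
  exists W.
    apply: (subconj_conjr hU ZW); apply: subconj_sub => // x Xx.
    by split; [exact: XU | exact: Xk].
  exists (dcoset U k V); first by exists k.
  by move=> _ [v Vv <-]; exists 1; [case: hU | exists v; rewrite ?mul1g].
- move=> C W W' /Cg[x Cx] _ _ [_ [g [_ -> gW]]] CD [_ [g' [_ -> gW']]] CD'.
  have Zg : conj_in U (Zset g U V) (Zset g' U V).
    apply: (conj_in_trans hU (Zset_dcoset hV (CD _ Cx))).
    exact: (conj_in_sym hU (Zset_dcoset hV (CD' _ Cx))).
  apply: (ccl_uniq hU).
  exact: (conj_in_trans hU (conj_in_trans hU (conj_in_sym hU gW) Zg) gW').
Qed.

End DoubleCosets.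

Lemma fsum_congr (V : nmodType) (T : choiceType) (A : set T) (F F' : T -> V) :
  (forall x, A x -> F x = F' x) -> \sum_(x \in A) F x = \sum_(x \in A) F' x.
Proof. by move=> FF'; apply: eq_fsbigr => x /set_mem/FF'. Qed.

(** * Marks over a ring containing Q *)

Section Marks.
Variables (G : profiniteGroupType) (S : comNzRingType).
Variable h : {rmorphism rat -> S}.

Lemma mulr_ratV_mulrn (x : S) (n : nat) : (0 < n)%N ->
  (x * h n%:R^-1) *+ n = x.
Proof.
move=> n0; rewrite -mulr_natr -mulrA -(rmorph_nat h) -rmorphM mulVf.
  by rewrite rmorph1 mulr1.
by rewrite pnatr_eq0 -lt0n.
Qed.

Lemma mulrIn_rat (x y : S) (n : nat) : (0 < n)%N -> x *+ n = y *+ n -> x = y.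
Proof.
move=> n0 E; have := mulr_ratV_mulrn (x - y) n0.
by rewrite -mulrnAl mulrnBl E subrr mul0r => /esym/subr0_eq.
Qed.

(** X is a bare set, so that one X can be used both in U and in K, and replaced by its
    conjugates. *)
Definition mark (K X : set G) (b : ccl K -> S) : S :=
  \sum_(V \in [set V : ccl K | subconj K X (val V)])
     b V *+ fixpts X K (val V).

Lemma markD1 (K : set G) (W : ccl K) (b : ccl K -> S) : open_subgroup K ->
  mark (val W) b = b W *+ fixpts (val W) K (val W) +
    \sum_(V \in [set V : ccl K | subconj K (val W) (val V)] `\ W)
      b V *+ fixpts (val W) K (val V).
Proof.
move=> hK; rewrite /mark (fsbigD1 W)//.
  by apply: subconj_finite; exact: osubgroupP.
exact: subconj_sub.
Qed.

Lemma mark_inj (K : set G) (b b' : ccl K -> S) : open_subgroup K ->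
  (forall X : osubgroup K, mark X b = mark X b') -> b = b'.
Proof.
move=> hK E; apply/funext => W; have [n] := ubnP (gindex K (val W)).
elim: n W => // n IH W; rewrite ltnS => leWn.
have hW := osubgroupP (val W); have := E (val W).
rewrite !markD1//.
rewrite [X in _ + X = _](_ : _ = \sum_(i \in
   [set V : ccl K | subconj K (val W) (val V)] `\ W)
     b' i *+ fixpts (val W) K (val i)); last first.
  apply: fsum_congr => V [/= WV nVW]; rewrite IH//.
  apply: leq_trans leWn; apply: gindex_lt => //; try exact: osubgroupP.
    exact: osubgroup_sub.
  by move/(ccl_uniq hK).
move/addIr; apply: mulrIn_rat; apply: fixpts_gt0 => //; exact: osubgroup_sub.
Qed.

Lemma mark_conj (K : set G) X Y (b : ccl K -> S) : open_subgroup K ->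
  conj_in K X Y -> mark X b = mark Y b.
Proof.
move=> hK XY; rewrite /mark.
rewrite (_ : [set V : ccl K | subconj K X (val V)] =
             [set V : ccl K | subconj K Y (val V)]); last first.
  apply/seteqP; split => V /=; apply: (subconj_conjl hK) => //.
  exact: conj_in_sym.
apply: fsum_congr => V _; case: XY => k Kk ->.
by rewrite fixpts_conjl//; exact: osubgroupP.
Qed.

(* n is fuel: the value at W only involves V of smaller index, and is the right
   one as soon as n is at least the index of W. *)
Fixpoint solve_marks (K : set G) (e : set G -> S) (n : nat) : ccl K -> S :=
  if n is n'.+1 then fun W : ccl K =>
    (e (val W) - \sum_(V \in [set V : ccl K | subconj K (val W) (val V)] `\ W)
       solve_marks e n' V *+ fixpts (val W) K (val V))
    * h (fixpts (val W) K (val W))%:R^-1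
  else fun=> 0.

Lemma solve_marks_stable (K : set G) (e : set G -> S) n m (W : ccl K) :
    open_subgroup K ->
    (gindex K (val W) <= n)%N -> (gindex K (val W) <= m)%N ->
  solve_marks e n W = solve_marks e m W.
Proof.
move=> hK; have hO (V : ccl K) := osubgroupP (val V).
elim: n m W => [|n IH] [|m] W; rewrite ?leqn0 => Wn Wm //.
- by have := gindex_gt0 hK (hO W); rewrite (eqP Wn).
- by have := gindex_gt0 hK (hO W); rewrite (eqP Wm).
rewrite /=; congr (( _ - _) * _); apply: fsum_congr => V [/= WV nVW].
have VW : (gindex K (val V) < gindex K (val W))%N.
  apply: gindex_lt => //; first exact: osubgroup_sub.
  by move/(ccl_uniq hK).
by rewrite (IH m)// -ltnS; exact: (leq_trans VW).
Qed.

(** Back substitution along the index, dividing by phi_W(K/W) at each W. It provides the existence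
    on which the choice in [necklace] rests. *)
Lemma mark_surj (K : set G) (e : set G -> S) : open_subgroup K ->
    (forall X Y : osubgroup K, conj_in K X Y -> e X = e Y) ->
  exists b : ccl K -> S, forall X : osubgroup K, mark X b = e X.
Proof.
move=> hK eC; have hO (V : ccl K) := osubgroupP (val V).
pose b (W : ccl K) := solve_marks e (gindex K (val W)) W.
exists b => X; have [W XW] := ccl_ex hK X.
rewrite (mark_conj _ hK XW) (eC _ _ XW) markD1// {1}/b.
have := gindex_gt0 hK (hO W); case E : (gindex _ _) => [//|n] _ /=.
rewrite mulr_ratV_mulrn; last exact: (fixpts_gt0 hK (hO W) (@osubgroup_sub _ _ _)).
rewrite [X in _ - X](_ : _ = \sum_(V \in
   [set V : ccl K | subconj K (val W) (val V)] `\ W)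
     b V *+ fixpts (val W) K (val V)) ?subrK//.
apply: fsum_congr => V [/= WV nVW]; congr (_ *+ _).
(* The recursive call has fuel n = (K:W) - 1, while [b V] has fuel (K:V), which is at most n. *)
apply: solve_marks_stable => //; rewrite -ltnS -E.
apply: gindex_lt => //; first exact: osubgroup_sub.
by move/(ccl_uniq hK).
Qed.

Lemma mark_necklace (K : set G) (r : S) (X : osubgroup K) : open_subgroup K ->
  mark X (necklace (K := K) r) = r ^+ gindex K X.
Proof.
move=> hK; move: X; rewrite /necklace.
apply: (@xgetPex _ _ [set M : ccl K -> S | forall U : osubgroup K,
  mark U M = r ^+ gindex K U]).
apply: (mark_surj (e := fun X => r ^+ gindex K X)) => // X Y [k Kk ->].
by rewrite gindex_conjr//; exact: osubgroupP.
Qed.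

(** Both sides equal the sum of phi_X(K/V) x_V over the classes of U: the left one by grouping the V
    that are conjugate in K, the right one by counting along K/V -> K/U. *)
Lemma mark_Ind (K U X : set G) (x : ccl U -> S) :
    open_subgroup K -> open_subgroup U -> open_subgroup X -> U `<=` K ->
  mark X (Ind K U x) =
  \sum_(C \in fixcosets X K U) mark (conjset (crep C)^-1%g X) x.
Proof.
move=> hK hU hX UK; have hO (V : ccl U) := osubgroupP (val V).
have [_ KM KV _] := hK.
pose A : set (ccl U) := [set V : ccl U | subconj K X (val V)].
have fA : finite_set A by exact: subconj_finite.
transitivity (\sum_(V \in A) x V *+ fixpts X K (val V)).
  rewrite (fsum_partition A [set W : ccl K | subconj K X (val W)]
    (fun (V : ccl U) (W : ccl K) => conj_in K (val V) (val W)))//; first last.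
  - move=> V W W' _ _ _ VW VW'; apply: (ccl_uniq hK).
    exact: (conj_in_trans hK (conj_in_sym hK VW)).
  - move=> V XV; have VK : val V `<=` K.
      by apply: subset_trans UK; exact: osubgroup_sub.
    have [W] := ccl_ex hK (mk_osubgroup (hO V) VK).
    rewrite mk_osubgroupE => VW; exists W => //.
    exact: (subconj_conjr hK VW).
  - exact: subconj_finite.
  apply: fsum_congr => W /= XW; rewrite /Ind.
  rewrite -fsumMnl; last first.
    apply: sub_finite_set (subconj_finite K U (osubgroupP (val W))) => V.
    by move=> /= [k Kk ->]; exists k.
  rewrite (_ : [set V : ccl U | conj_in K (val V) (val W)] =
    [set V : ccl U | A V /\ conj_in K (val V) (val W)]); last first.
    apply/seteqP; split => V /= => [VW|[]//]; split => //.
    exact: (subconj_conjr hK (conj_in_sym hK VW)).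
  apply: fsum_congr => V [_ [k Kk ->]]; rewrite fixpts_conjr//.
transitivity (\sum_(V \in A) \sum_(C \in fixcosets X K U)
    x V *+ fixpts (conjset (crep C)^-1%g X) U (val V)).
  apply: fsum_congr => V _; rewrite fsumMnr; last exact: fixcosets_finite.
  by rewrite (fixpts_tower X hK hU (hO V) UK)//; exact: osubgroup_sub.
rewrite exchange_fsbig//; last exact: fixcosets_finite.
(* For a given C = gU, a V in A to which g^-1Xg is not subconjugate inside U contributes no fixed
   point. *)
apply: fsum_congr => C fC; symmetry; apply: fsum_sub => V; last first.
  by move=> _ nV; rewrite fixpts_eq0// mulr0n.
have Kg : K (crep C).
  case: fC => [[k Kk <-] _]; have [u /UK Ku <-] := crepP (lcoset_refl k hU).
  exact: KM.
move=> /= [k Uk]; rewrite conjset_subl invgK conjsetM => XV.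
by exists (crep C * k)%g => //; apply: KM => //; exact: UK.
Qed.

(** By [mark_Ind], each of the phi_X(K/U) fixed cosets gU contributes the mark at g^-1Xg of the
    necklace family of a(U). This is a(U) to the power (U:g^-1Xg), whatever g, hence the U-th term
    of the ghost component. *)
Lemma mark_tauQ (K X : set G) (a : wmap K S) : open_subgroup K ->
  open_subgroup X -> mark X (tauQ a) = ghost X a.
Proof.
move=> hK hX; have hO (V : ccl K) := osubgroupP (val V).
have fF := subconj_finite K K hX.
rewrite /mark /tauQ /ghost.
transitivity (\sum_(W \in [set W : ccl K | subconj K X (val W)])
   \sum_(U \in [set U : ccl K | subconj K X (val U)])
    Ind K (val U) (necklace (K := val U) (a (val U))) W *+ fixpts X K (val W)).
  apply: fsum_congr => W /= XW; rewrite fsumMnl//; congr (_ *+ _).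
  (* If a class V of U is conjugate to W, which lies above X, then U lies above X too. *)
  symmetry; apply: fsum_sub => //= U _ nXU; apply: fsbig1 => V VW; case: nXU.
  apply: (subconj_trans hK XW).
  apply: (subconj_conjl hK VW); apply: subconj_sub => //.
  exact: osubgroup_sub.
rewrite exchange_fsbig//; apply: fsum_congr => U XU.
have UK : val U `<=` K by exact: osubgroup_sub.
rewrite -[LHS]/(mark X (Ind K (val U) (necklace (K := val U) (a (val U))))).
rewrite mark_Ind// fixptsE -fsum_const; last exact: fixcosets_finite.
apply: fsum_congr => C fC; set g := crep C.
have Cg : C g.
  by rewrite /g; case: fC => [[k _ <-] _]; exact: (crepP (lcoset_refl k (hO U))).
have [CE XC] := fixcosets_coset (hO U) fC Cg.
have Kg : K g.
  have [_ KM _ _] := hK.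
  by case: fC => [[k Kk E] _]; move: Cg; rewrite -E => -[u /UK Ku <-]; exact: KM.
have XU' : conjset g^-1%g X `<=` val U by rewrite conjset_subl invgK.
rewrite (index_conjE hK (hO U) hX UK XC Kg).
have := mark_necklace (a (val U))
  (mk_osubgroup (open_subgroupJ g^-1%g hX) XU') (hO U).
by rewrite mk_osubgroupE.
Qed.

(** A common X gives the same finite range of V for all W above it, so that the sums over V and W
    can be exchanged. *)
Lemma ResQ_finiteE (K U : set G) (b : ccl K -> S) (W : ccl U) X :
    open_subgroup K -> open_subgroup U -> U `<=` K ->
    subconj U X (val W) ->
  ResQ K U b W = \sum_(V \in [set V : ccl K | subconj K X (val V)])
    b V *+ #|` fset_set (dcosets K U (val V) (val W))|.
Proof.
move=> hK hU UK XW; have hO (V : ccl K) := osubgroupP (val V).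
rewrite /ResQ -(fsum_sub [set V : ccl K | subconj K X (val V)])//.
  by apply: fsum_congr => V _; rewrite fsum_const//; exact: dcosets_finite.
move=> V _ /= nXV; apply: fsbig1 => D dD; case: nXV.
by apply: (dcosets_subconj hK UK (hO V) XW); exists D.
Qed.

Lemma mark_ResQ (K U X : set G) (b : ccl K -> S) :
    open_subgroup K -> open_subgroup U -> open_subgroup X ->
    U `<=` K -> X `<=` U ->
  mark X (ResQ K U b) = mark X b.
Proof.
move=> hK hU hX UK XU; have hO (V : ccl K) := osubgroupP (val V).
have fK := subconj_finite K K hX.
have fU := subconj_finite U U hX.
transitivity (\sum_(W \in [set W : ccl U | subconj U X (val W)])
  \sum_(V \in [set V : ccl K | subconj K X (val V)])
    b V *+ (#|` fset_set (dcosets K U (val V) (val W))| * fixpts X U (val W))).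
  apply: fsum_congr => W /= XW; rewrite (ResQ_finiteE b hK hU UK XW).
  by rewrite -fsumMnl//; apply: fsum_congr => V _; rewrite mulrnA.
rewrite exchange_fsbig//; apply: fsum_congr => V _.
by rewrite fsumMnr// (fixpts_Mackey hK hU UK hX (hO V) XU).
Qed.

Lemma ResQ_tauQ (K U : set G) (a : wmap K S) (a' : wmap U S) :
    open_subgroup K -> open_subgroup U -> U `<=` K ->
    (forall X : osubgroup U, ghost X a' = ghost X a) ->
  ResQ K U (tauQ a) = tauQ a'.
Proof.
move=> hK hU UK E; apply: mark_inj => // X; have hX := osubgroupP X.
rewrite mark_ResQ//; last exact: osubgroup_sub.
by rewrite !mark_tauQ// E.
Qed.

End Marks.

(** * The two restrictions and theta *)

Section ResTheta.
Variables (G : profiniteGroupType) (S : comNzRingType).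
Variable h : {rmorphism rat -> S}.
Variables (K U : set G).
Hypotheses (hK : open_subgroup K) (hU : open_subgroup U) (UK : U `<=` K).

Lemma subconj_refl (W : ccl U) : subconj U (val W) (val W).
Proof. exact: subconj_sub. Qed.

Lemma ResQD (b b' : ccl K -> S) : ResQ K U (b \+ b') = ResQ K U b \+ ResQ K U b'.
Proof.
apply/funext => W /=; rewrite !(ResQ_finiteE _ hK hU UK (subconj_refl W)).
rewrite -fsbig_split/=; last by apply: subconj_finite; exact: osubgroupP.
by apply: fsum_congr => V _; rewrite mulrnDl.
Qed.

Lemma thetaQD (b b' : ccl K -> S) : thetaQ (b \+ b') = thetaQ b \+ thetaQ b'.
Proof. by apply/funext => V; rewrite /thetaQ /= mulrnDl. Qed.

Lemma bResQ_thetaQ (b : ccl K -> S) :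
  bResQ h K U (thetaQ b) = thetaQ (ResQ K U b).
Proof.
apply/funext => W; rewrite /thetaQ (ResQ_finiteE _ hK hU UK (subconj_refl W)).
have fF := subconj_finite K K (osubgroupP (val W)).
rewrite -fsumMnl// /bResQ.
rewrite -(fsum_sub [set V : ccl K | subconj K (val W) (val V)])//; last first.
  move=> V _ nWV; apply: fsbig1 => D dD; case: nWV.
  apply: (dcosets_subconj hK UK (osubgroupP (val V)) (subconj_refl W)).
  by exists D.
apply: fsum_congr => V _; have hV := osubgroupP (val V).
rewrite fsum_const; last exact: dcosets_finite.
rewrite mulrnAC; congr (_ *+ _).
rewrite -[b V *+ _]mulr_natr mulrCA -(rmorph_nat h) -rmorphM mulfVK.
  by rewrite rmorph_nat mulr_natr.
by rewrite pnatr_eq0 -lt0n; exact: gindex_gt0.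
Qed.

Lemma thetaQ_surj (b : ccl K -> S) : exists b', thetaQ b' = b.
Proof.
exists (fun V => b V * h (gindex K (val V))%:R^-1); apply/funext => V.
by apply: mulr_ratV_mulrn; apply: gindex_gt0 => //; exact: osubgroupP.
Qed.

(** Inherited from [ResQ], since over a ring containing Q every family is in the image of
    [thetaQ]. *)
Lemma bResQD (b b' : ccl K -> S) :
  bResQ h K U (b \+ b') = bResQ h K U b \+ bResQ h K U b'.
Proof.
have [c <-] := thetaQ_surj b; have [c' <-] := thetaQ_surj b'.
rewrite -thetaQD !bResQ_thetaQ ResQD.
by apply/funext => V; rewrite /thetaQ /= mulrnDl.
Qed.

End ResTheta.

(** * The zero of W_K(A) and the additivity of tau *)

Section Witt.
Variables (G : profiniteGroupType) (K : set G).
Hypothesis hK : open_subgroup K.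

Lemma wmap_eq (A : Type) (a b : wmap K A) : a =1 b -> a = b.
Proof.
case: a b => [a ca] [b cb] /= /funext E; move: cb; rewrite -E => cb.
by congr WMap; exact: Prop_irrelevance.
Qed.

Lemma ghost_comp (A B : comNzRingType) (h : {rmorphism A -> B}) (X : set G)
    (a : wmap K A) : open_subgroup X -> ghost X (wmap_comp h a) = h (ghost X a).
Proof.
move=> hX; have fF := subconj_finite K K hX.
rewrite /ghost !fsbig_finite// rmorph_sum; apply: eq_bigr => W _.
by rewrite rmorphMn rmorphXn.
Qed.

(** Induction on the index: in the component at W, the terms of smaller index are positive powers of
    0. What remains is a positive multiple of a power of a(W), and Z has neither torsion nor
    nilpotents. *)
Lemma ghost_int_eq0 (a : wmap K int) :
  (forall X : osubgroup K, ghost X a = 0) -> a = wmap0 int K.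
Proof.
move=> a0; apply: wmap_eq => V /=; have [n] := ubnP (gindex K V).
elim: n V => // n IH V; rewrite ltnS => leVn.
have [W VW] := ccl_ex hK V; rewrite (wmap_class a VW).
have hO (V : ccl K) := osubgroupP (val V).
have : (gindex K (val W) <= n)%N.
  by case: VW => k Kk ->; rewrite gindex_conjr//; exact: osubgroupP.
move: W {V leVn VW} => W leWn; have := a0 (val W); rewrite /ghost.
have WF : [set V : ccl K | subconj K (val W) (val V)] W by apply: subconj_sub.
rewrite (fsbigD1 W _ _ (subconj_finite K K (hO W)) WF) /=.
rewrite [X in _ + X]fsbig1 => [|V [/= WV nVW]]; last first.
  rewrite IH ?expr0n ?gtn_eqF ?mul0rn//.
    exact: (index_conj_gt0 hK (hO V) (hO W) (@osubgroup_sub _ _ _) WV).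
  apply: leq_trans leWn.
  apply: (gindex_lt hK (hO V) (hO W) (@osubgroup_sub _ _ _) WV).
  by move/(ccl_uniq hK).
rewrite addr0 => /eqP; rewrite mulrn_eq0 expf_eq0.
rewrite gtn_eqF; last exact: (fixpts_gt0 hK (hO W) (@osubgroup_sub _ _ _)).
by move=> /andP[_ /eqP].
Qed.

Lemma zmod_morphism0 (A B : zmodType) (f : A -> B) : zmod_morphism f -> f 0 = 0.
Proof. by move=> fB; rewrite -(subrr 0) fB subrr. Qed.

Variable w : wittBurnside K.

(** The map W_K(Z) -> W_K(A) is additive and, being composition with Z -> A, sends the zero map to
    the zero map. *)
Lemma witt0 (A : comNzRingType) : (0 : witt w A) = wmap0 A K.
Proof.
have E : (0 : witt w int) = wmap0 int K.
  apply: ghost_int_eq0 => X.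
  exact: (zmod_morphism0 (witt_ghost_hom w int X).1).
have := zmod_morphism0 (witt_map_hom w (intmul 1 : {rmorphism int -> A})).1.
by rewrite -/(witt w A) => <-; rewrite E; apply: wmap_eq => V.
Qed.

Lemma ghost_wmap0 (A : comNzRingType) (X : osubgroup K) : ghost X (wmap0 A K) = 0.
Proof. by rewrite -witt0; exact: (zmod_morphism0 (witt_ghost_hom w A X).1). Qed.

(** Marks turn tau into ghost components, which are additive on W_K(R) and commute with i. *)
Lemma tauQB (R S : comNzRingType) (i : {rmorphism R -> S})
    (h : {rmorphism rat -> S}) (a b : witt w R) :
  tauQ (wmap_comp i (a - b : witt w R)) =
  tauQ (wmap_comp i a) \- tauQ (wmap_comp i b).
Proof.
apply: (mark_inj h hK) => X; have hX := osubgroupP X.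
have -> : mark X (tauQ (wmap_comp i a) \- tauQ (wmap_comp i b)) =
    mark X (tauQ (wmap_comp i a)) - mark X (tauQ (wmap_comp i b)).
  rewrite /mark !fsbig_finite//; try exact: subconj_finite.
  by rewrite -sumrB; apply: eq_bigr => V _; rewrite mulrnBl.
rewrite !(mark_tauQ h)// !ghost_comp// -rmorphB; congr (i _).
exact: (witt_ghost_hom w R X).1.
Qed.

End Witt.

(** * Cosets and induced maps *)

Section Quotients.
Variables (V : Type) (S : zmodType).
Implicit Types (I : set (V -> S)) (x y k : V -> S).

Definition fun_subgroup I : Prop :=
  I (fun=> 0) /\ forall k l, I k -> I l -> I (k \- l).

Lemma mem_coset_self I x : fun_subgroup I -> [set x \+ k | k in I] x.
Proof.
by move=> [I0 _]; exists (fun=> 0) => //; apply/funext => v /=; rewrite addr0.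
Qed.

Lemma fun_coset_eq I x y : fun_subgroup I -> [set x \+ k | k in I] y ->
  [set x \+ k | k in I] = [set y \+ k | k in I].
Proof.
move=> [I0 IB] [k Ik <-]; apply/seteqP; split => _ [l Il <-].
  exists (l \- k); first exact: IB.
  by apply/funext => v /=; rewrite -addrA [k v + _]addrC subrK.
exists (l \- ((fun=> 0) \- k)); first by apply: (IB) => //; exact: IB.
by apply/funext => v /=; rewrite sub0r opprK -addrA [k v + _]addrC.
Qed.

End Quotients.

(** The coset of F x contains the image of x + I, so the choice succeeds; any admissible choice
    contains F x and thus is that coset. *)
Lemma inducedE (V V' : Type) (S S' : zmodType) (X I : set (V -> S))
    (X' I' : set (V' -> S')) (F : (V -> S) -> V' -> S') (c0 : quotient X' I')
    (C : quotient X I) (x : V -> S) :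
    fun_subgroup I -> fun_subgroup I' ->
    (forall y z, F (y \+ z) = F y \+ F z) -> (forall k, I k -> I' (F k)) ->
    X' (F x) -> val C = [set x \+ k | k in I] ->
  val (induced F c0 C) = [set F x \+ k | k in I'].
Proof.
move=> hI hI' FD FI X'Fx CE; rewrite /induced.
set C' := xget _ _; have : [set C' : quotient X' I' | F @` val C `<=` val C'] C'.
  apply: xgetPex; exists (coset I' (exist (fun y => y \in X') _ (mem_set X'Fx))).
  move=> _ [y + <-]; rewrite CE => -[k Ik <-]; rewrite FD.
  by exists (F k) => //; exact: FI.
move=> /(_ (F x)) h; have C'x : val C' (F x).
  by apply: h; exists x => //; rewrite CE; exact: mem_coset_self.
have /set_mem [y _ E] := valP C'; rewrite E in C'x *; exact: (fun_coset_eq hI').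
Qed.

(** * Quotients by the families coming from ker rho *)

Section TorsionCase.
Variables (G : profiniteGroupType) (R R' S : comNzRingType).
Variables (rho : {rmorphism R' -> R}) (i : {rmorphism R' -> S}).
Variable h : {rmorphism rat -> S}.
Variable K : set G.
Hypothesis hK : open_subgroup K.
Variable w : wittBurnside K.

Lemma wkerE (a : wmap K R') : wker rho a <-> wmap_comp rho a = wmap0 R K.
Proof.
split=> [a0|E V]; first by apply: wmap_eq => V; exact: a0.
by rewrite -[LHS]/(wmap_comp rho a V) E.
Qed.

Lemma wmap_compB (a b : witt w R') : wmap_comp rho (a - b : witt w R') =
  (wmap_comp rho a : witt w R) - (wmap_comp rho b : witt w R) :> witt w R.
Proof. exact: (witt_map_hom w rho).1. Qed.

(** By [wkerE] and [witt0], W_K(ker rho) is the kernel of the additive map W_K(rho), and [tauQB]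
    transports its closure under subtraction. *)
Lemma DeltaKer_subgroup : fun_subgroup (DeltaKer rho i (K := K)).
Proof.
split.
  exists (wmap0 R' K); first by move=> V; rewrite rmorph0.
  (* Writing 0 as 0 - 0 turns tau(0) into tau(0) - tau(0). *)
  rewrite -(witt0 hK w) -(subrr (0 : witt w R')) (tauQB hK i h).
  by apply/funext => V /=; rewrite subrr.
move=> _ _ [a /wkerE a0 <-] [b /wkerE b0 <-].
exists ((a : witt w R') - (b : witt w R')); last exact: (tauQB hK i h).
by apply/wkerE; rewrite wmap_compB a0 b0 -(witt0 hK w) subrr.
Qed.

Lemma APKer_subgroup : fun_subgroup (APKer rho i (K := K)).
Proof.
have [D0 DB] := DeltaKer_subgroup; split.
  by exists (fun=> 0) => //; apply/funext => V; rewrite /thetaQ mul0rn.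
move=> _ _ [k Dk <-] [l Dl <-]; exists (k \- l); first exact: DB.
by apply/funext => V; rewrite /thetaQ /= mulrnBl.
Qed.

(** Two lifts of a differ in W_K(R') by an element of W_K(ker rho), so a single coset contains the
    images of all lifts. *)
Lemma tauTE (a : wmap K R) (a' : wmap K R') : wmap_comp rho a' = a ->
  val (tauT rho i a) =
  [set tauQ (wmap_comp i a') \+ k | k in DeltaKer rho i (K := K)].
Proof.
move=> a'E; rewrite /tauT.
set C := xget _ _; have : [set C : DeltaT rho i K | forall a' : wmap K R',
    wmap_comp rho a' = a -> val C (val (tauTF i a'))] C.
  apply: xgetPex; exists (coset (DeltaKer rho i (K := K)) (tauTF i a')) => b bE.
  exists (tauQ (wmap_comp i b) \- tauQ (wmap_comp i a')); last first.
    by apply/funext => V /=; rewrite addrC subrK.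
  exists ((b : witt w R') - (a' : witt w R')); last exact: (tauQB hK i h).
  by apply/wkerE; rewrite wmap_compB a'E bE subrr -(witt0 hK w).
move=> /(_ _ a'E) Ca; have /set_mem [x _ E] := valP C.
by rewrite E in Ca *; exact: (fun_coset_eq DeltaKer_subgroup).
Qed.

End TorsionCase.

(** * The identities for a coefficient ring in each of the three cases *)

Section Restriction.
Variables (G : profiniteGroupType) (K U : set G).
Hypotheses (hK : open_subgroup K) (hU : open_subgroup U) (UK : U `<=` K).
Variables (wK : wittBurnside K) (wU : wittBurnside U).
Variable f : forall A : comNzRingType, witt wK A -> witt wU A.
Arguments f : clear implicits.
Hypothesis hf : is_witt_restriction f.

Lemma witt_restriction0 (A : comNzRingType) : f A (wmap0 A K) = wmap0 A U.
Proof.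
have [fN fG] := hf.
have f0 : f int (wmap0 int K) = wmap0 int U.
  apply: (ghost_int_eq0 hU) => X; rewrite fG.
  have XK : X `<=` K by apply: subset_trans UK; exact: osubgroup_sub.
  have := ghost_wmap0 hK wK int (mk_osubgroup (osubgroupP X) XK).
  by rewrite mk_osubgroupE.
have int0 L : wmap_comp (intmul 1 : {rmorphism int -> A}) (wmap0 int L)
    = wmap0 A L by exact: wmap_eq.
by rewrite -!int0 fN f0.
Qed.

Lemma ResQ_restriction (R S : comNzRingType) (i : {rmorphism R -> S})
    (h : {rmorphism rat -> S}) (a : witt wK R) :
  ResQ K U (tauQ (wmap_comp i a)) = tauQ (wmap_comp i (f R a)).
Proof.
apply: (ResQ_tauQ h) => // X; have hX := osubgroupP X.
by rewrite !ghost_comp// hf.2.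
Qed.

(** By naturality along rho and f(0) = 0, f sends W_K(ker rho) into W_U(ker rho). *)
Lemma ResQ_DeltaKer (R R' S : comNzRingType) (rho : {rmorphism R' -> R})
    (i : {rmorphism R' -> S}) (h : {rmorphism rat -> S}) (k : ccl K -> S) :
  DeltaKer rho i k -> DeltaKer rho i (ResQ K U k).
Proof.
move=> [a /wkerE a0 <-]; exists (f R' a).
  by apply/wkerE; rewrite -hf.1 a0 witt_restriction0.
by rewrite ResQ_restriction.
Qed.

Lemma Res_tau (R : comNzRingType) (c : coef_case R) (a : witt wK R) :
  Res c K U (tau c K a) = tau c U (f R a).
Proof.
case: c a => [h|S i h _ _ _|R' S rho i h _ _ rho_surj _] a /=.
- apply: (ResQ_tauQ h) => // X; exact: hf.2.
(* The value is tau of f(a), hence in [DeltaTF i U], and [insubd] keeps it. *)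
- apply: val_inj; rewrite /ResTF insubdK /= ?(ResQ_restriction i h)//.
  by apply: mem_set; exists (f R a).
- have rhoK x : exists y, rho y = x by have [y _ <-] := rho_surj x I; exists y.
  (* A set-theoretic section of rho suffices to lift a, since composing with any function preserves
     constancy on classes; f of the lift then lifts f(a) by naturality. *)
  have [s sE] := choice rhoK.
  pose a' : wmap K R' := wmap_comp s a.
  have a'E : wmap_comp rho a' = a by apply: wmap_eq => V; exact: sE.
  have fa'E : wmap_comp rho (f R' a') = f R a by rewrite -hf.1 a'E.
  apply: val_inj; rewrite (tauTE i h hU wU fa'E).
  rewrite -(ResQ_restriction i h); apply: inducedE.
  + exact: DeltaKer_subgroup.
  + exact: DeltaKer_subgroup.
  + exact: ResQD.
  + exact: ResQ_DeltaKer.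
  + by rewrite (ResQ_restriction i h); exists (f R' a').
  + exact: (tauTE i h hK wK).
Qed.

Lemma bRes_theta (R : comNzRingType) (c : coef_case R) (x : Delta c K) :
  bRes c K U (theta c K x) = theta c U (Res c K U x).
Proof.
case: c x => [h|S i h ? ? ?|R' S rho i h ? ? ? ?] x /=.
- exact: bResQ_thetaQ.
- have /set_mem [a _ aE] := valP x.
  have Dx : DeltaTF i U (ResQ K U (val x)).
    by rewrite -aE (ResQ_restriction i h); exists (f R a).
  have xE : val (ResTF U (x : DeltaTF i K)) = ResQ K U (val x).
    exact: insubdK (mem_set Dx).
  apply: val_inj; rewrite /bResTF insubdK /= ?xE; first exact: bResQ_thetaQ.
  by rewrite bResQ_thetaQ//; apply: mem_set; exists (ResQ K U (val x)).
- have /set_mem [_ [a _ <-] xE] := valP x.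
  set t := tauQ _ in xE.
  have Dt : DeltaTF i U (ResQ K U t).
    by rewrite (ResQ_restriction i h); exists (f R' a).
  (* Stated for a general L because theta is evaluated on K on one side and on U on the other. *)
  have thE (L : set G) (wL : wittBurnside L) y (C : DeltaT rho i L)
      (hL : open_subgroup L) : DeltaTF i L y ->
      val C = [set y \+ k | k in DeltaKer rho i (K := L)] ->
      val (thetaT C) = [set thetaQ y \+ k | k in APKer rho i (K := L)].
    move=> Dy CE; rewrite /thetaT; apply: (inducedE _ _ _ _ _ _ CE).
    + exact: DeltaKer_subgroup.
    + exact: APKer_subgroup.
    + exact: thetaQD.
    + by move=> k Dk; exists k.
    + by exists y.
  apply: val_inj; rewrite (thE U wU (ResQ K U t))//; last first.
    apply: (inducedE _ _ _ _ _ _ xE) => //.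
    + exact: DeltaKer_subgroup.
    + exact: DeltaKer_subgroup.
    + exact: ResQD.
    + exact: ResQ_DeltaKer.
  rewrite -(bResQ_thetaQ h hK hU UK); apply: inducedE.
  + exact: APKer_subgroup.
  + exact: APKer_subgroup.
  + exact: bResQD.
  + move=> _ [k Dk <-]; rewrite bResQ_thetaQ//.
    by exists (ResQ K U k) => //; exact: ResQ_DeltaKer.
  + by rewrite bResQ_thetaQ//; exists (ResQ K U t).
  + by apply: (thE K wK) => //; exists a.
Qed.

End Restriction.

Theorem proposition5p5 (G : profiniteGroupType) (R : comNzRingType)
    (c : coef_case R) (U : osubgroup [set: G])
    (wG : wittBurnside [set: G]) (wU : wittBurnside U)
    (f : forall A : comNzRingType, witt wG A -> witt wU A)
    (hf : is_witt_restriction f) :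
  [/\ Res c [set: G] U \o tau c [set: G] =1 tau c U \o f R,
      bRes c [set: G] U \o theta c [set: G] =1 theta c U \o Res c [set: G] U
    & bRes c [set: G] U \o gamma c [set: G] =1 gamma c U \o f R].
Proof.
have hG := open_subgroupT G; have hU := osubgroupP U.
have UG : U `<=` [set: G] by [].
split=> [a|x|a] /=.
- exact: (Res_tau hG hU UG hf).
- exact: (bRes_theta hG hU UG hf).
- by rewrite /gamma /= (bRes_theta hG hU UG hf) (Res_tau hG hU UG hf).
Qed.
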